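(* (Good action 1.) We get a faithful, good action ${}_\triangleright$ of the face monoid $\widehat{\mathcal W}$ on the Coxeter complex $\mathcal C$ in the following way: Let $\sigma_1\varepsilon(R(\Theta))\sigma_2\in\widehat{\mathcal W}$ ($\sigma_1,\sigma_2\in\mathcal W$, $\Theta\subseteq I$ special) and $\tau\mathcal W_J\in\mathcal C$. Decompose $\sigma_2\tau$ in the form $$\sigma_2\tau=a_1a_2\,y\,c$$ where $a_1\in\mathcal W_{\Theta^\bot}$, $a_2\in\mathcal W_\Theta$, $y\in{}^{\Theta\cup\Theta^\bot}\mathcal W^J$ and $c\in\mathcal W_J$. Define $$\sigma_1\varepsilon(R(\Theta))\sigma_2\;{}_\triangleright\;\tau\mathcal W_J:=\sigma_1a_1\mathcal W_{\Theta\cup J\cup red(y)} .$$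
   Context: $A=(a_{ij})_{i,j\in I}$ ($I$ finite) is a symmetrizable generalized Cartan matrix with a minimal realization over $\mathbb R$: a real vector space $\mathfrak h_{\mathbb R}$ of dimension $2|I|-\mathrm{rank}\,A$, linearly independent $(h_i)_{i\in I}$ in $\mathfrak h_{\mathbb R}$ and linearly independent $(\alpha_i)_{i\in I}$ in $\mathfrak h_{\mathbb R}^*$ with $\alpha_j(h_i)=a_{ij}$. The Weyl group $\mathcal W$ is the Coxeter group generated by the simple reflections $\sigma_i$ ($i\in I$), acting on $\mathfrak h_{\mathbb R}^*$ by $\sigma_i\lambda=\lambda-\lambda(h_i)\alpha_i$. For $J\subseteq I$: $\mathcal W_J=\langle\sigma_j\mid j\in J\rangle$; $\mathcal W^J$ (resp. ${}^J\mathcal W$) is the set of minimal length representatives of $\mathcal W/\mathcal W_J$ (resp. $\mathcal W_J\backslash\mathcal W$); ${}^K\mathcal W^J={}^K\mathcal W\cap\mathcal W^J$. $red(\sigma)\subseteq I$ is the set of indices of simple reflections occurring in a (any) reduced expression of $\sigma$. $J^\bot=\{i\in I\mid a_{ij}=0\ \forall j\in J\}$. $J^\infty$ is the union of the connected components of $J$ for which the corresponding submatrix of $A$ is not of finite type ($\emptyset^\infty=\emptyset$). $\Theta\subseteq I$ is special if $\Theta=\Theta^\infty$. The Tits cone is $X=\mathcal W\{\lambda\in\mathfrak h_{\mathbb R}^*\mid\lambda(h_i)\ge0\ \forall i\in I\}$; faces of $X$ are (nonempty) faces of the convex cone $X$ in the sense of convex geometry. For $\Theta$ special, $R(\Theta)=\{\lambda\in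 X\mid\lambda(h_i)=0\ \forall i\in\Theta\}$ is a face, and every face is $\sigma R(\Theta)$ with $\sigma\in\mathcal W$ and a unique special $\Theta$. **Face monoid $\widehat{\mathcal W}$.** On the set of pairs $(\sigma,R)$ ($\sigma\in\mathcal W$, $R$ a face of $X$) with product $(\sigma,R)(\tau,S)=(\sigma\tau,\tau^{-1}R\cap S)$ consider the congruence $(\sigma,R)\sim(\sigma',R')$ iff $R=R'$ and $\sigma^{-1}\sigma'$ fixes $R$ pointwise. $\widehat{\mathcal W}$ is the quotient monoid; $\sigma\varepsilon(R)$ is the class of $(\sigma,R)$, $\varepsilon(R)=1\varepsilon(R)$, and $\sigma\in\mathcal W$ is identified with $\sigma\varepsilon(X)$. Every element of $\widehat{\mathcal W}$ has the form $\sigma_1\varepsilon(R(\Theta))\sigma_2$. $\widehat{\mathcal W}_J=\{\sigma\varepsilon(\tau R(\Theta))\mid\sigma,\tau\in\mathcal W_J,\ \Theta\subseteq J\text{ special}\}$ is the standard parabolic submonoid of type $J$. **Coxeter complex and good actions.** $\mathcal C=\{\sigma\mathcal W_J\mid\sigma\in\mathcal W,J\subseteq I\}$, ordered by reverse inclusion; $\mathcal W$ acts by left multiplication. An action of $\widehat{\mathcal W}$ on $\mathcal C$ extending the action of $\mathcal W$ is called good if (1) $\mathrm{Stab}_{\widehat{\mathcal W}}(\mathcal W_J)=\widehat{\mathcal W}_J$ for all $J\subseteq I$, and (2) $\widehat{\mathcal W}$ acts order preservingly on $\mathcal C$. *)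

(* Defs.v *)
From HB Require Import structures.
From mathcomp Require Import all_boot all_order all_algebra generic_quotient.
From mathcomp Require Import all_classical reals interval_inference convex.

Set Implicit Arguments.
Unset Strict Implicit.
Unset Printing Implicit Defensive.

Import Order.TTheory GRing.Theory Num.Theory.

Local Open Scope classical_set_scope.
Local Open Scope convex_scope.
Local Open Scope ring_scope.
Local Open Scope quotient_scope.

Record gcm (I : finType) := Gcm {
  gcm_entry :> I -> I -> int;
  gcm_diag : forall i, gcm_entry i i = 2;
  gcm_offdiag : forall i j, i != j -> gcm_entry i j <= 0;
  gcm_zero : forall i j, gcm_entry i j = 0 -> gcm_entry j i = 0 }.

Definition symmetrizable (R : fieldType) (I : finType) (A : gcm I) : Prop :=
  exists2 d : I -> R, (forall i, d i != 0) &
    forall i j, d i * (A i j)%:~R = d j * (A j i)%:~R.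

Definition gcm_submx (R : fieldType) (I : finType) (A : gcm I) (K : {set I}) :
    'M[R]_#|K| :=
  \matrix_(i, j) (A (enum_val i) (enum_val j))%:~R.

(* Case (Fin) of the Fin/Aff/Ind trichotomy for indecomposable generalized
   Cartan matrices (Kac, Infinite dimensional Lie algebras, Theorem 4.3);
   only used below for connected components, hence indecomposable matrices. *)
Definition finite_type (R : realType) (n : nat) (M : 'M[R]_n) : Prop :=
  [/\ \det M != 0,
      exists u : 'cV[R]_n, (forall i, 0 < u i 0) /\
                           (forall i, 0 < (M *m u) i 0)
    & forall v : 'cV[R]_n, (forall i, 0 <= (M *m v) i 0) ->
                           (forall i, 0 < v i 0) \/ v = 0].

Section SubsetsOfI.
Context (R : realType) (I : finType) (A : gcm I).
Implicit Types J : {set I}.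

Definition orth J : {set I} := [set i : I | [forall j in J, A i j == 0]].

Definition component J (i : I) : {set I} :=
  [set k | connect (fun a b => [&& a \in J, b \in J & A a b != 0]) i k].

Definition infty_part J : {set I} :=
  [set i in J | ~~ `[< finite_type (gcm_submx R A (component J i)) >]].

Definition special J : Prop := J = infty_part J.

End SubsetsOfI.

(* [h] is the real vector space, [coroot i] is h_i, [root i] is alpha_i *)
Record minimal_realization (R : realType) (I : finType) (A : gcm I)
    (h : vectType R) := MinimalRealization {
  coroot : I -> h;
  root : I -> 'Hom(h, R^o);
  coroot_free : free [seq coroot i | i <- enum I];
  root_free : free [seq root i | i <- enum I];
  root_coroot : forall i j, root j (coroot i) = (A i j)%:~R;
  realization_dim :
    \dim {:h} = (2 * #|I| - \rank (gcm_submx R A [set: I]))%N }.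

Section WeylGroup.
Context (R : realType) (I : finType) (A : gcm I) (h : vectType R).
Context (D : minimal_realization A h).
Local Notation V := 'Hom(h, R^o).

Definition reflection_fun (i : I) (lam : V) : V :=
  lam - (lam (coroot D i) : R) *: root D i.

Fact reflection_fun_is_linear i : linear (reflection_fun i).
Proof.
move=> a u v; rewrite /reflection_fun add_lfunE scale_lfunE.
by rewrite scalerBr scalerDl -scalerA opprD addrACA.
Qed.

HB.instance Definition _ i := GRing.isLinear.Build R V V *:%R
  (reflection_fun i) (reflection_fun_is_linear i).

Definition reflection i : 'End(V) := linfun (reflection_fun i).

Lemma reflectionE i lam :
  reflection i lam = lam - (lam (coroot D i) : R) *: root D i.
Proof. by rewrite lfunE. Qed.

Lemma reflectionK i : (reflection i \o reflection i = \1)%VF.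
Proof.
apply/lfunP => lam; rewrite comp_lfunE id_lfunE !reflectionE.
rewrite add_lfunE opp_lfunE scale_lfunE root_coroot gcm_diag.
set a := (lam _ : R).
have -> : a - a *: (2%:~R : R^o) = - a.
  by rewrite /GRing.scale /= mulr_natr mulr2n opprD addrA subrr add0r.
by rewrite scaleNr opprK subrK.
Qed.

Definition reflections (s : seq I) : 'End(V) :=
  foldr (fun i f => (reflection i \o f)%VF) \1%VF s.

Lemma reflections_cat s t :
  reflections (s ++ t) = (reflections s \o reflections t)%VF.
Proof.
elim: s => [|i s IHs] /=; first by rewrite comp_lfun1l.
by rewrite IHs comp_lfunA.
Qed.

Lemma reflections_rev s : (reflections (rev s) \o reflections s = \1)%VF.
Proof.
elim: s => [|i s IHs]; first by rewrite comp_lfun1l.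
rewrite rev_cons -cats1 reflections_cat /= comp_lfun1r.
by rewrite comp_lfunA -(comp_lfunA _ (reflection i) (reflection i)) reflectionK comp_lfun1r.
Qed.

(* The simple reflections are involutions, so the subgroup of GL(V) that they
   generate consists of their products. *)
Record weyl := Weyl {
  weyl_lfun :> 'End(V);
  weyl_lfunP : `[< exists s, weyl_lfun = reflections s >] }.

HB.instance Definition _ := [isSub for weyl_lfun].
HB.instance Definition _ := [Choice of weyl by <:].

Lemma weyl_wordP (w : weyl) : exists s, weyl_lfun w = reflections s.
Proof. exact: asboolW (weyl_lfunP w). Qed.

Definition weyl_of_word s : weyl :=
  @Weyl (reflections s) (asboolT (ex_intro _ s erefl)).

Fact weyl_mul_subproof (v w : weyl) :
  `[< exists s, (weyl_lfun v \o weyl_lfun w)%VF = reflections s >].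
Proof.
apply/asboolP; have [s ->] := weyl_wordP v; have [t ->] := weyl_wordP w.
by exists (s ++ t); rewrite reflections_cat.
Qed.

Definition weyl_mul v w : weyl := Weyl (weyl_mul_subproof v w).

Definition weyl_inv (w : weyl) : weyl :=
  weyl_of_word (rev (projT1 (cid (weyl_wordP w)))).

Fact weyl_mulA : associative weyl_mul.
Proof. by move=> u v w; apply: val_inj; rewrite /= comp_lfunA. Qed.

Fact weyl_mul1 : left_id (weyl_of_word [::]) weyl_mul.
Proof. by move=> w; apply: val_inj; rewrite /= comp_lfun1l. Qed.

Fact weyl_mul1r : right_id (weyl_of_word [::]) weyl_mul.
Proof. by move=> w; apply: val_inj; rewrite /= comp_lfun1r. Qed.

Fact weyl_mulV : left_inverse (weyl_of_word [::]) weyl_inv weyl_mul.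
Proof.
move=> w; apply: val_inj; rewrite /= /weyl_inv; case: cid => s /= ->.
exact: reflections_rev.
Qed.

Fact weyl_mulrV : right_inverse (weyl_of_word [::]) weyl_inv weyl_mul.
Proof.
move=> w; apply: val_inj; rewrite /= /weyl_inv; case: cid => s /= ->.
by have := reflections_rev (rev s); rewrite revK.
Qed.

HB.instance Definition _ := isGroup.Build weyl
  weyl_mulA weyl_mul1 weyl_mul1r weyl_mulV weyl_mulrV.

Lemma weyl_mulE (v w : weyl) lam : (v * w)%g lam = v (w lam).
Proof. by rewrite comp_lfunE. Qed.

Lemma weyl_oneE lam : (1%g : weyl) lam = lam.
Proof. by rewrite id_lfunE. Qed.

Lemma weylK (w : weyl) lam : (w^-1)%g (w lam) = lam.
Proof. by rewrite -weyl_mulE mulVg weyl_oneE. Qed.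

Lemma weylVK (w : weyl) lam : w ((w^-1)%g lam) = lam.
Proof. by rewrite -weyl_mulE mulgV weyl_oneE. Qed.

Definition simple (i : I) : weyl := weyl_of_word [:: i].

Definition word (s : seq I) : weyl := (\prod_(i <- s) simple i)%g.

Lemma wordE s : word s = weyl_of_word s.
Proof.
apply: val_inj; rewrite /word; elim: s => [|i s IHs]; first by rewrite big_nil.
by rewrite big_cons /= IHs comp_lfun1r.
Qed.

Fact weyl_length_subproof (w : weyl) :
  exists n, `[< exists2 s, size s = n & word s = w >].
Proof.
have [s ws] := weyl_wordP w; exists (size s); apply/asboolP; exists s => //.
by rewrite wordE; apply: val_inj.
Qed.

Definition weyl_length (w : weyl) : nat := ex_minn (weyl_length_subproof w).

Definition reduced_word (w : weyl) (s : seq I) : Prop :=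
  word s = w /\ size s = weyl_length w.

Definition red (w : weyl) : {set I} :=
  [set i | `[< exists2 s, reduced_word w s & i \in s >]].

Definition parabolic (J : {set I}) : set weyl :=
  [set w | exists2 s, {subset s <= J} & w = word s].

(* W^J, the minimal length representatives of W / W_J; [min_left] is the
   counterpart for W_J \ W *)
Definition min_right (J : {set I}) : set weyl :=
  [set w | forall u, parabolic J u ->
             (weyl_length w <= weyl_length (w * u)%g)%N].

Definition min_left (J : {set I}) : set weyl :=
  [set w | forall u, parabolic J u ->
             (weyl_length w <= weyl_length (u * w)%g)%N].

Definition dominant : set V := [set lam | forall i, 0 <= (lam (coroot D i) : R)].

Definition tits_cone : set V :=
  [set mu | exists (w : weyl) lam, dominant lam /\ mu = w lam].

(* The improper face [tits_cone] is listed separately: the Tits cone is convex,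
   so it satisfies the second alternative, but this is a theorem. *)
Definition is_face (F : set V) : Prop :=
  F = tits_cone \/
  [/\ F !=set0, F `<=` tits_cone, convex_set (F : set (convex_lmodType V))
    & forall (x y : convex_lmodType V) (t : {i01 R}),
        tits_cone x -> tits_cone y -> 0 < t%:num < 1 ->
        F (x <| t |> y) -> F x /\ F y].

Record face := Face { face_set :> set V; face_setP : `[< is_face face_set >] }.

HB.instance Definition _ := [isSub for face_set].
HB.instance Definition _ := [Choice of face by <:].

Lemma is_face_face (F : face) : is_face F.
Proof. exact: asboolW (face_setP F). Qed.

Lemma tits_cone_weyl (w : weyl) x : tits_cone x -> tits_cone (w x).
Proof.
by move=> [v [lam [Clam ->]]]; exists (w * v)%g, lam; rewrite weyl_mulE.
Qed.

Lemma tits_cone0 : tits_cone 0.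
Proof. by exists 1%g, 0; rewrite linear0; split=> // i; rewrite lfunE. Qed.

Lemma tits_coneZ a x : 0 <= a -> tits_cone x -> tits_cone (a *: x).
Proof.
move=> a0 [w [lam [Clam ->]]]; exists w, (a *: lam); rewrite linearZ; split=> //.
by move=> i; rewrite scale_lfunE; apply: mulr_ge0.
Qed.

Lemma convE (x y : convex_lmodType V) (t : {i01 R}) :
  x <| t |> y = t%:num *: (x : V) + (1 - t%:num) *: (y : V).
Proof. by []. Qed.

Lemma weyl_conv (w : weyl) (x y : convex_lmodType V) (t : {i01 R}) :
  w (x <| t |> y) = (w x : convex_lmodType V) <| t |> w y.
Proof. by rewrite !convE linearD !linearZ. Qed.

Lemma face_sub F : is_face F -> F `<=` tits_cone.
Proof. by move=> [-> //|[]]. Qed.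

Lemma face_has0 F : is_face F -> F 0.
Proof.
move=> [->|[[x Fx] FX _ extF]]; first exact: tits_cone0.
have h0 : 0 <= 2%:R^-1 :> R by rewrite invr_ge0 ler0n.
have h1 : 2%:R^-1 <= 1 :> R by rewrite invf_le1 ?ltr0n// ler1n.
pose t : {i01 R} := Itv01 h0 h1.
have t01 : 0 < t%:num < 1 by rewrite /= invr_gt0 ltr0n invf_lt1 ?ltr0n ?ltr1n.
suff [] : F 0 /\ F (2%:R *: x) by [].
apply: (extF 0 (2%:R *: x) t) => //; first exact: tits_cone0.
  by apply: tits_coneZ; [exact: ler0n|exact: FX].
rewrite convE scaler0 add0r scalerA /= (_ : (1 - _) * _ = 1) ?scale1r//.
by rewrite mulrBl mul1r mulVf ?pnatr_eq0// -[2%:R]/(1 + 1) addrK.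
Qed.

Fact full_face_subproof : `[< is_face tits_cone >].
Proof. by apply/asboolP; left. Qed.

Definition full_face : face := Face full_face_subproof.

Fact face_cap_subproof (F G : face) : `[< is_face (F `&` G) >].
Proof.
apply/asboolP.
have [FX GX] := (face_sub (is_face_face F), face_sub (is_face_face G)).
have [F0 G0] := (face_has0 (is_face_face F), face_has0 (is_face_face G)).
have [->|[_ _ cF eF]] := is_face_face F.
  by rewrite setIC setIidl//; exact: is_face_face.
have [->|[_ _ cG eG]] := is_face_face G.
  by rewrite setIidl//; exact: is_face_face.
right; split; first by exists 0.
- by move=> x [/FX].
- move=> x y t; rewrite !inE => -[Fx Gx] [Fy Gy]; split; apply: set_mem.
    by apply: cF; apply/mem_set.
  by apply: cG; apply/mem_set.
- move=> x y t Xx Xy t01 [Fxy Gxy].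
  have [Fx Fy] := eF x y t Xx Xy t01 Fxy.
  by have [Gx Gy] := eG x y t Xx Xy t01 Gxy.
Qed.

Definition face_cap F G : face := Face (face_cap_subproof F G).

Lemma weyl_image (w : weyl) (F : set V) x :
  (weyl_lfun w @` F) x <-> F ((w^-1)%g x).
Proof.
split=> [[y Fy <-]|Fx]; first by rewrite weylK.
by exists ((w^-1)%g x); rewrite ?weylVK.
Qed.

Fact face_act_subproof (w : weyl) (F : face) :
  `[< is_face (weyl_lfun w @` F) >].
Proof.
apply/asboolP; have FX := face_sub (is_face_face F).
have F0 := face_has0 (is_face_face F).
have [FE|[_ _ cF eF]] := is_face_face F; [left|right].
  apply/seteqP; split=> x.
    by move/weyl_image; rewrite FE => /(tits_cone_weyl w); rewrite weylVK.
  by move=> Xx; apply/weyl_image; rewrite FE; exact: tits_cone_weyl.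
split; first by exists 0, 0 => //; rewrite linear0.
- by move=> x /weyl_image /FX /(tits_cone_weyl w); rewrite weylVK.
- move=> x y t; rewrite !inE => /weyl_image Fx /weyl_image Fy.
  apply/weyl_image; rewrite weyl_conv; apply: set_mem.
  by apply: cF; apply/mem_set.
- move=> x y t Xx Xy t01 /weyl_image; rewrite weyl_conv => Fxy.
  have [Fx Fy] := eF _ _ t (tits_cone_weyl (w^-1)%g Xx)
    (tits_cone_weyl (w^-1)%g Xy) t01 Fxy.
  by split; apply/weyl_image.
Qed.

Definition face_act (w : weyl) (F : face) : face := Face (face_act_subproof w F).

Lemma face_actE w F x :
  face_set (face_act w F) x <-> face_set F ((w^-1)%g x).
Proof. exact: weyl_image. Qed.

Lemma face_ext (F G : face) :
  (forall x, face_set F x <-> face_set G x) -> F = G.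
Proof. by move=> FG; apply: val_inj; apply/seteqP; split=> x /FG. Qed.

Definition RTheta (Theta : {set I}) : set V :=
  tits_cone `&` [set lam | forall i, i \in Theta -> (lam (coroot D i) : R) = 0].

(* [RTheta Theta] is a face when [Theta] is special (a theorem); only this case
   is used, the default value [full_face] of [insubd] never comes up. *)
Definition std_face (Theta : {set I}) : face :=
  insubd full_face (RTheta Theta).

Definition pair_equiv (p q : weyl * face) : bool :=
  `[< p.2 = q.2 /\ forall x, face_set p.2 x -> ((p.1)^-1 * q.1)%g x = x >].

Lemma pair_equivE p q : pair_equiv p q <->
  p.2 = q.2 /\ forall x, face_set p.2 x -> p.1 x = q.1 x.
Proof.
rewrite /pair_equiv; split=> [/asboolP[pq e]|[pq e]]; last first.
  by apply/asboolP; split=> // x Fx; rewrite weyl_mulE -e// weylK.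
split=> // x Fx; have := e x Fx; rewrite weyl_mulE => /(congr1 p.1).
by rewrite weylVK.
Qed.

Fact pair_equiv_refl : reflexive pair_equiv.
Proof. by move=> p; apply/pair_equivE. Qed.

Fact pair_equiv_sym : symmetric pair_equiv.
Proof.
by move=> p q; apply/idP/idP => /pair_equivE[e f]; apply/pair_equivE;
  split=> // x Fx; rewrite f// e.
Qed.

Fact pair_equiv_trans : transitive pair_equiv.
Proof.
move=> q p r /pair_equivE[e f] /pair_equivE[e' f']; apply/pair_equivE.
by split=> [|x Fx]; rewrite ?e// f// f'// -e.
Qed.

Canonical pair_equiv_rel :=
  EquivRel pair_equiv pair_equiv_refl pair_equiv_sym pair_equiv_trans.

Definition pair_mul (p q : weyl * face) : weyl * face :=
  ((p.1 * q.1)%g, face_cap (face_act (q.1)^-1%g p.2) q.2).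

Lemma pair_mul_congr p p' q q' : pair_equiv p p' -> pair_equiv q q' ->
  pair_equiv (pair_mul p q) (pair_mul p' q').
Proof.
move=> /pair_equivE[e f] /pair_equivE[e' f']; apply/pair_equivE.
split=> [|x [/face_actE]].
  apply: face_ext => x; split=> -[/face_actE Fx Gx]; split; try apply/face_actE.
  - by move: Fx; rewrite !invgK -e -f'.
  - by rewrite -e'.
  - by move: Fx; rewrite !invgK -e -f'// e'.
  - by move: Gx; rewrite -e'.
by rewrite invgK => Fx Gx; rewrite !weyl_mulE -f'// f.
Qed.

Definition face_monoid := {eq_quot pair_equiv_rel}.

HB.instance Definition _ := Choice.on face_monoid.

(* the class of the pair (w, F) *)
Definition sigma_eps (w : weyl) (F : face) : face_monoid :=
  (\pi_({eq_quot pair_equiv_rel}) (w, F))%qT.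

Definition face_monoid_mul (x y : face_monoid) : face_monoid :=
  let p := pair_mul (repr x) (repr y) in sigma_eps p.1 p.2.

Lemma sigma_epsP v w F G : sigma_eps v F = sigma_eps w G <->
  F = G /\ forall x, face_set F x -> v x = w x.
Proof.
split=> [/eqP|vw]; first by rewrite eqmodE => /pair_equivE.
by apply/eqP; rewrite eqmodE; apply/pair_equivE.
Qed.

Lemma sigma_eps_ind (P : face_monoid -> Prop) :
  (forall w F, P (sigma_eps w F)) -> forall x, P x.
Proof. move=> Pwf x; rewrite -[x]reprK; case: (repr x) => w F; exact: Pwf. Qed.

Lemma face_monoid_mulE v F w G :
  face_monoid_mul (sigma_eps v F) (sigma_eps w G) =
  sigma_eps (v * w)%g (face_cap (face_act w^-1%g F) G).
Proof.
have repr_equiv u H : pair_equiv (repr (sigma_eps u H)) (u, H).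
  rewrite -/(pair_equiv_rel _ _) -eqmodE; apply/eqP.
  exact: (reprK (sigma_eps u H)).
apply/eqP; rewrite /face_monoid_mul /sigma_eps -surjective_pairing eqmodE.
exact: pair_mul_congr (repr_equiv v F) (repr_equiv w G).
Qed.

Fact face_monoid_mulA : associative face_monoid_mul.
Proof.
elim/sigma_eps_ind => u F; elim/sigma_eps_ind => v G.
elim/sigma_eps_ind => w H; rewrite !face_monoid_mulE mulgA; congr sigma_eps.
apply: face_ext => x; split.
  move=> [/face_actE Fx [/face_actE Gx Hx]]; split=> //; apply/face_actE.
  by split=> //; apply/face_actE; move: Fx; rewrite !invgK weyl_mulE.
move=> [/face_actE[/face_actE Fx Gx] Hx]; split; last first.
  by split=> //; apply/face_actE.
by apply/face_actE; move: Fx; rewrite !invgK weyl_mulE.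
Qed.

Lemma face_act1 F : face_act 1%g F = F.
Proof.
have act1x x : (1^-1 : weyl)%g x = x by rewrite invg1 weyl_oneE.
apply: face_ext => x; split; first by move/face_actE; rewrite act1x.
by move=> Fx; apply/face_actE; rewrite act1x.
Qed.

Lemma face_act_full w : face_act w full_face = full_face.
Proof.
apply: face_ext => x; split; last by move=> Xx; apply/face_actE/tits_cone_weyl.
by move/face_actE/(tits_cone_weyl w); rewrite weylVK.
Qed.

Lemma face_cap_fulll F : face_cap full_face F = F.
Proof.
apply: face_ext => x; split=> [[]//|Fx]; split=> //.
exact: face_sub (is_face_face F) _ Fx.
Qed.

Lemma face_cap_fullr F : face_cap F full_face = F.
Proof.
apply: face_ext => x; split=> [[]//|Fx]; split=> //.
exact: face_sub (is_face_face F) _ Fx.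
Qed.

Fact face_monoid_mul1 : left_id (sigma_eps 1%g full_face) face_monoid_mul.
Proof.
elim/sigma_eps_ind => w F.
by rewrite face_monoid_mulE mul1g face_act_full face_cap_fulll.
Qed.

Fact face_monoid_mul1r : right_id (sigma_eps 1%g full_face) face_monoid_mul.
Proof.
elim/sigma_eps_ind => w F.
by rewrite face_monoid_mulE mulg1 invg1 face_act1 face_cap_fullr.
Qed.

HB.instance Definition _ := isMonoid.Build face_monoid
  face_monoid_mulA face_monoid_mul1 face_monoid_mul1r.

(* the identification of W with a submonoid of the face monoid *)
Definition of_weyl (w : weyl) : face_monoid := sigma_eps w full_face.

Definition eps (F : face) : face_monoid := sigma_eps 1%g F.

Definition std_parabolic (J : {set I}) : set face_monoid :=
  [set x | exists (sigma tau : weyl) (Theta : {set I}), [/\ parabolic J sigma, parabolic J tau,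
     Theta \subset J, special R A Theta &
     x = sigma_eps sigma (face_act tau (std_face Theta))]].

Definition left_coset (w : weyl) (J : {set I}) : set weyl :=
  [set (w * u)%g | u in parabolic J].

Record coxeter_complex := CoxeterComplex {
  cc_set :> set weyl;
  cc_setP : `[< exists w J, cc_set = left_coset w J >] }.

HB.instance Definition _ := [isSub for cc_set].
HB.instance Definition _ := [Choice of coxeter_complex by <:].

Definition cc_coset (w : weyl) (J : {set I}) : coxeter_complex :=
  @CoxeterComplex (left_coset w J)
    (asboolT (ex_intro _ w (ex_intro _ J erefl))).

Definition cc_le (c d : coxeter_complex) : Prop := cc_set d `<=` cc_set c.

Definition monoid_action (M : monoidType) (T : Type) (act : M -> T -> T) :
    Prop :=
  (forall t, act 1%g t = t) /\
  (forall x y t, act (x * y)%g t = act x (act y t)).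

Definition faithful_action (M T : Type) (act : M -> T -> T) : Prop :=
  forall x y, (forall t, act x t = act y t) -> x = y.

Implicit Type act : face_monoid -> coxeter_complex -> coxeter_complex.

Definition extends_weyl act : Prop :=
  forall (w : weyl) (c : coxeter_complex),
    cc_set (act (of_weyl w) c) = [set (w * u)%g | u in cc_set c].

Definition good_action act : Prop :=
  [/\ monoid_action act, extends_weyl act,
      forall J, [set x | act x (cc_coset 1%g J) = cc_coset 1%g J] =
                std_parabolic J
    & forall x c d, cc_le c d -> cc_le (act x c) (act x d)].

Definition decomposition (Theta J : {set I}) (w a1 a2 y c : weyl) : Prop :=
  [/\ parabolic (orth A Theta) a1, parabolic Theta a2,
      (min_left (Theta :|: orth A Theta) `&` min_right J) y,
      parabolic J c & w = (a1 * a2 * y * c)%g].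

Definition given_by_decomposition act : Prop :=
  forall (sigma1 sigma2 tau : weyl) (Theta J : {set I}) (a1 a2 y c : weyl),
    special R A Theta ->
    decomposition Theta J (sigma2 * tau)%g a1 a2 y c ->
    act (of_weyl sigma1 * eps (std_face Theta) * of_weyl sigma2)%g
        (cc_coset tau J) =
    cc_coset (sigma1 * a1)%g (Theta :|: J :|: red y).

End WeylGroup.

(* Main.v *)
Require Import Defs.
From mathcomp Require Import all_boot all_order all_algebra.
From mathcomp Require Import all_classical reals.
From mathcomp Require Import interval_inference convex zify ring lra.

(** The cosets w W_J correspond to the facets of the Tits cone X: w W_J is
represented by the point w p_J, where p_J takes the value 0 on the h_i with i in
J and 1 on the others ([facet_point]).  Larger cosets are smaller facets, and
the stabilizer of p_J is W_J.

Fix a face F of X.  If w p_J and w p_K lie in F then so does w p_(J cap K), because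
F is a convex cone, extreme in X, and w p_J + w p_K lies in the facet of
w W_(J cap K).  As 0 lies in F, there is a smallest coset containing a given coset
C and represented in F: its type is [face_hull].  Let eps(F) send C to this
coset and let sigma eps(F) apply sigma afterwards.  If sigma fixes F pointwise
it fixes the cosets represented in F, so this is well defined.  The smallest
coset above C in F cap G is reached by first going up to G and then up to F, which
gives the action axiom; order preservation is immediate, and faithfulness holds
since the cosets fixed by eps(F) recover F, and the points of F recover sigma on
F.

What remains is to compare with the formula of the statement and to know all
faces.  For w = a1 a2 y c as in the statement, w p_K lies in R(Theta) if and only
if y p_K does, that is, if and only if the coroots y^-1 h_i, i in Theta, which
are positive, have their support in K.  By [special_support] this forces y to lie
in W_K and Theta in K; so the smallest K containing J is the union of Theta, J
and red(y).  And every face is w R(Theta) for a special Theta: take for Theta the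
smallest type of a coset represented in the face ([face_classification]).

That Theta is special enters always through the same argument.  Suppose that a
set of real coroots is finite and closed under those reflections s_k, k in a
component K of Theta, that increase the height.  A coroot of greatest height in
the set pairs nonnegatively with every alpha_k, k in K, and its coordinates on K
then exhibit the Cartan matrix of K as one of finite type
([finite_type_of_coroot]).  Finiteness comes from the fact that an element of
the Weyl group makes only finitely many positive real coroots negative.
Conversely, for K of finite type an invariant positive definite form bounds the
coroots, which allows to move any functional into the dominant chamber of K.

Everything rests on the sign rule for real coroots: w h_i is a nonnegative
combination of the simple coroots when w s_i is not shorter than w
([length_le_pos]). *)

Set Implicit Arguments.
Unset Strict Implicit.
Unset Printing Implicit Defensive.

Import Order.TTheory GRing.Theory Num.Theory.
Local Open Scope ring_scope.

(** * The coroot lattice, words and parabolic subgroups *)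

Section CorootLattice.
Context (R : realType) (I : finType) (A : gcm I) (h : vectType R).
Context (D : minimal_realization A h).
Local Notation V := 'Hom(h, R^o).
Local Notation Q := {ffun I -> int}.
Implicit Types (lam mu : V) (b c : Q) (w v : weyl D) (i j k : I).

(** The integer combinations of the simple coroots are handled by their
coordinates b, and the Weyl group acts on them by transposition of its action on
functionals. *)
Definition ev lam b : R := \sum_i (b i)%:~R * (lam (coroot D i) : R).

Definition sroot i : Q := [ffun j => (j == i)%:R].

Definition pairing b i : int := \sum_k b k * A k i.

Definition qrefl i b : Q := [ffun j => b j - (j == i)%:R * pairing b i].

Lemma evD lam b c : ev lam (b + c) = ev lam b + ev lam c.
Proof.
rewrite /ev -big_split /=; apply: eq_bigr => i _.
by rewrite ffunE rmorphD /= mulrDl.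
Qed.

Lemma evN lam b : ev lam (- b) = - ev lam b.
Proof.
rewrite /ev -sumrN; apply: eq_bigr => i _.
by rewrite ffunE rmorphN /= mulNr.
Qed.

Lemma ev_sroot lam i : ev lam (sroot i) = lam (coroot D i).
Proof.
rewrite /ev (bigD1 i) //= big1 ?addr0 => [|j ji]; rewrite ffunE ?eqxx ?mul1r //.
by rewrite (negbTE ji) mul0r.
Qed.

Lemma ev_linD lam mu b : ev (lam + mu) b = ev lam b + ev mu b.
Proof.
rewrite /ev -big_split /=; apply: eq_bigr => i _.
by rewrite add_lfunE mulrDr.
Qed.

Lemma ev_linZ (x : R) lam b : ev (x *: lam) b = x * ev lam b.
Proof.
rewrite /ev mulr_sumr /=; apply: eq_bigr => i _.
by rewrite scale_lfunE /GRing.scale /= mulrCA.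
Qed.

Lemma ev_linN lam b : ev (- lam) b = - ev lam b.
Proof. by rewrite -scaleN1r ev_linZ mulN1r. Qed.

Lemma ev_root i b : ev (Defs.root D i) b = (pairing b i)%:~R.
Proof.
rewrite /ev /pairing rmorph_sum /=; apply: eq_bigr => k _.
by rewrite root_coroot rmorphM.
Qed.

(** Position of the i-th simple coroot in the free family that the realization
provides. *)
Definition coroot_index i : 'I_(size [seq coroot D i | i <- enum I]) :=
  cast_ord (esym (size_map _ _)) (cast_ord (cardE I) (enum_rank i)).

(** The dual coordinates of the free family of simple coroots give functionals
with arbitrary values on them. *)
Definition weight (f : I -> R) : V :=
  \sum_i f i *: linfun
    (coord (in_tuple [seq coroot D i | i <- enum I]) (coroot_index i) : h -> R^o).

Lemma weightE f i : weight f (coroot D i) = f i.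
Proof.
rewrite /weight sum_lfunE (bigD1 i) //= big1 ?addr0 => [|j ji].
all: rewrite scale_lfunE lfunE /=; set X := in_tuple _.
all: have -> : coroot D i = X`_(coroot_index i)
       by rewrite /= (nth_map i) -?cardE ?ltn_ord // nth_enum_rank.
all: rewrite coord_free; last exact: coroot_free.
  by rewrite eqxx /GRing.scale /= mulr1.
have -> : (coroot_index i == coroot_index j) = false.
  by rewrite !(inj_eq (@cast_ord_inj _ _ _)) (inj_eq enum_rank_inj) eq_sym (negbTE ji).
by rewrite /GRing.scale /= mulr0.
Qed.

Lemma ev_inj b c : (forall lam, ev lam b = ev lam c) -> b = c.
Proof.
move=> E; apply/ffunP => i; have := E (weight (fun j => (j == i)%:R)).
have S d : ev (weight (fun j => (j == i)%:R)) d = (d i)%:~R.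
  rewrite /ev (bigD1 i) //= big1 ?addr0 => [|j ji]; rewrite weightE ?eqxx ?mulr1 //.
  by rewrite (negbTE ji) mulr0.
by rewrite !S => /intr_inj.
Qed.

Lemma ev_qrefl lam i b : ev (reflection D i lam) b = ev lam (qrefl i b).
Proof.
have -> : qrefl i b = b - [ffun j => (j == i)%:R * pairing b i].
  by apply/ffunP => j; rewrite !ffunE.
rewrite evD evN reflectionE ev_linD ev_linN ev_linZ ev_root; congr (_ - _).
rewrite /ev (bigD1 i) //= big1 ?addr0 => [|j ji]; rewrite ffunE ?eqxx ?mul1r.
  by rewrite mulrC.
by rewrite (negbTE ji) !mul0r.
Qed.

Definition qword (s : seq I) b : Q := foldr qrefl b s.

Lemma ev_reflections lam s b : ev (reflections D s lam) (qword s b) = ev lam b.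
Proof.
elim: s lam b => [|i s IHs] lam b /=; first by rewrite id_lfunE.
rewrite comp_lfunE -ev_qrefl -(comp_lfunE (reflection D i)).
by rewrite reflectionK id_lfunE.
Qed.

(** The choice of a word of w does not matter: by [ev_qact] the value is
determined by its pairing with all functionals. *)
Definition qact w b : Q := qword (projT1 (cid (weyl_wordP w))) b.

Lemma ev_qact w lam b : ev (w lam) (qact w b) = ev lam b.
Proof. by rewrite /qact; case: cid => s /= ->; rewrite ev_reflections. Qed.

Lemma evV w lam b : ev (w lam) b = ev lam (qact w^-1%g b).
Proof. by rewrite -{2}(weylK w lam) ev_qact. Qed.

Lemma qact_mul v w b : qact (v * w)%g b = qact v (qact w b).
Proof.
apply: ev_inj => lam; rewrite -(weylVK (v * w)%g lam) ev_qact.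
by rewrite [in RHS]weyl_mulE !ev_qact.
Qed.

Lemma qact1 b : qact 1%g b = b.
Proof. by apply: ev_inj => lam; rewrite -{1}(weyl_oneE D lam) ev_qact. Qed.

Lemma qact_word s b : qact (word D s) b = qword s b.
Proof.
apply: ev_inj => lam; rewrite -(weylVK (word D s) lam) ev_qact.
by rewrite wordE ev_reflections.
Qed.

Lemma word1 i : word D [:: i] = simple D i.
Proof. by rewrite /word big_seq1. Qed.

Lemma qact_simple i b : qact (simple D i) b = qrefl i b.
Proof. by rewrite -word1 qact_word. Qed.

Lemma qactK w : cancel (qact w) (qact w^-1%g).
Proof. by move=> b; rewrite -qact_mul mulVg qact1. Qed.

Lemma qactVK w : cancel (qact w^-1%g) (qact w).
Proof. by move=> b; rewrite -qact_mul mulgV qact1. Qed.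

Lemma qactD w b c : qact w (b + c) = qact w b + qact w c.
Proof. by apply: ev_inj => lam; rewrite -(weylVK w lam) ev_qact !evD !ev_qact. Qed.

Lemma qactN w b : qact w (- b) = - qact w b.
Proof. by apply: ev_inj => lam; rewrite -(weylVK w lam) ev_qact !evN !ev_qact. Qed.

Lemma simpleK i : (simple D i * simple D i = 1)%g.
Proof. by apply: val_inj; rewrite /= !comp_lfun1r reflectionK. Qed.

Lemma simpleV i : ((simple D i)^-1 = simple D i)%g.
Proof. exact: mulg1_eq (simpleK i). Qed.

Lemma pairing_sroot i j : pairing (sroot i) j = A i j.
Proof.
rewrite /pairing (bigD1 i) //= big1 ?addr0 => [|k ki]; rewrite ffunE ?eqxx ?mul1r //.
by rewrite (negbTE ki) mul0r.
Qed.

Lemma qrefl_sroot i : qrefl i (sroot i) = - sroot i.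
Proof.
apply/ffunP => j; rewrite !ffunE pairing_sroot gcm_diag.
by ring.
Qed.

Lemma qrefl_neq i b j : j != i -> qrefl i b j = b j.
Proof. by move=> ji; rewrite ffunE (negbTE ji) mul0r subr0. Qed.

Lemma qact_mulr_simple w i : qact (w * simple D i)%g (sroot i) = - qact w (sroot i).
Proof. by rewrite qact_mul qact_simple qrefl_sroot qactN. Qed.

Lemma qact0 w : qact w 0 = 0.
Proof. by apply: (addrI (qact w 0)); rewrite -qactD !addr0. Qed.

Lemma qact_eq0 w b : qact w b = 0 -> b = 0.
Proof. by move=> E; rewrite -(qactK w b) E qact0. Qed.

Lemma sroot_neq0 i : sroot i <> 0.
Proof. by move/ffunP/(_ i); rewrite !ffunE eqxx. Qed.

Lemma word_cat s t : word D (s ++ t) = (word D s * word D t)%g.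
Proof. by rewrite /word big_cat. Qed.

Lemma word_cons i s : word D (i :: s) = (simple D i * word D s)%g.
Proof. by rewrite -cat1s word_cat word1. Qed.

Lemma word_rcons s i : word D (rcons s i) = (word D s * simple D i)%g.
Proof. by rewrite -cats1 word_cat word1. Qed.

Lemma word_nil : word D [::] = 1%g.
Proof. by rewrite /word big_nil. Qed.

Lemma word_rev s : word D (rev s) = (word D s)^-1%g.
Proof.
elim: s => [|i s IHs]; first by rewrite word_nil invg1.
by rewrite rev_cons word_rcons IHs word_cons invgM simpleV.
Qed.

Lemma reduced_exists w : exists s, reduced_word w s.
Proof.
rewrite /reduced_word /weyl_length; case: ex_minnP => n /asboolP[s sn sw] _.
by exists s.
Qed.

Lemma length_word s : (weyl_length (word D s) <= size s)%N.
Proof.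
rewrite /weyl_length; case: ex_minnP => n _; apply.
by apply/asboolP; exists s.
Qed.

Lemma length_eq0 w : weyl_length w = 0%N -> w = 1%g.
Proof.
have [s [<- <-]] := reduced_exists w.
by move/size0nil ->; rewrite word_nil.
Qed.

Lemma lengthV w : weyl_length w^-1%g = weyl_length w.
Proof.
have le v : (weyl_length v^-1%g <= weyl_length v)%N.
  have [s [<- <-]] := reduced_exists v.
  by rewrite -word_rev -size_rev length_word.
by apply/eqP; rewrite eqn_leq le -{1}(invgK w) le.
Qed.

Lemma length_mul v w : (weyl_length (v * w)%g <= weyl_length v + weyl_length w)%N.
Proof.
have [s [sv <-]] := reduced_exists v; have [t [tw <-]] := reduced_exists w.
by rewrite -sv -tw -word_cat -size_cat length_word.
Qed.

Implicit Types J K : {set I}.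

Lemma parabolic1 J : parabolic J (1%g : weyl D).
Proof. by exists [::]; rewrite ?word_nil. Qed.

Lemma parabolic_simple J i : i \in J -> parabolic J (simple D i).
Proof. by move=> iJ; exists [:: i]; rewrite ?word1 // => j; rewrite inE => /eqP->. Qed.

Lemma parabolicM J v w : parabolic J v -> parabolic J w -> parabolic J (v * w)%g.
Proof.
move=> [s sJ ->] [t tJ ->]; exists (s ++ t); rewrite ?word_cat // => i.
by rewrite mem_cat => /orP[/sJ|/tJ].
Qed.

Lemma parabolicV J w : parabolic J w -> parabolic J w^-1%g.
Proof. by move=> [s sJ ->]; exists (rev s); rewrite ?word_rev // => i; rewrite mem_rev => /sJ. Qed.

Lemma parabolicS J K w : J \subset K -> parabolic J w -> parabolic K w.
Proof. by move=> /fintype.subsetP JK [s sJ ->]; exists s => // i /sJ/JK. Qed.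

Lemma parabolic_ind J (P : weyl D -> Prop) : P 1%g ->
  (forall j w, j \in J -> parabolic J w -> P w -> P (simple D j * w)%g) ->
  forall w, parabolic J w -> P w.
Proof.
move=> P1 PS w [s + ->]; elim: s => [|i s IHs] sJ; first by rewrite word_nil.
have sJ' : {subset s <= J} by move=> j js; apply: sJ; rewrite inE js orbT.
rewrite word_cons; apply: PS; [by apply: sJ; rewrite inE eqxx| |exact: IHs].
by exists s.
Qed.

Lemma qact_parabolic_notin J w b j : parabolic J w -> j \notin J -> qact w b j = b j.
Proof.
move=> + jJ; elim/parabolic_ind => [|i {}w iJ _ IH]; first by rewrite qact1.
by rewrite qact_mul qact_simple qrefl_neq //; apply: contraNneq jJ => ->.
Qed.

Lemma qact_parabolic_pairing0 J w b : parabolic J w ->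
  (forall j, j \in J -> pairing b j = 0) -> qact w b = b.
Proof.
move=> + b0; elim/parabolic_ind => [|i {}w iJ _ IH]; first by rewrite qact1.
rewrite qact_mul qact_simple IH; apply/ffunP => j.
by rewrite ffunE b0 // mulr0 subr0.
Qed.

Lemma weyl_parabolic_fix J w lam : parabolic J w ->
  (forall j, j \in J -> lam (coroot D j) = 0) -> w lam = lam.
Proof.
move=> + l0; elim/parabolic_ind => [|i {}w iJ _ IH]; first exact: weyl_oneE.
by rewrite weyl_mulE IH /= comp_lfun1r reflectionE l0 // scale0r subr0.
Qed.

End CorootLattice.
(** * Length and sign of the real coroots *)

Section Positivity.
Context (R : realType) (I : finType) (A : gcm I) (h : vectType R).
Context (D : minimal_realization A h).
Local Notation V := 'Hom(h, R^o).
Local Notation Q := {ffun I -> int}.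
Implicit Types (lam mu : V) (b c : Q) (w v : weyl D) (i j k : I).

Definition qpos b : Prop := forall j, 0 <= b j.

Fixpoint alternating i j n : seq I := if n is n'.+1 then i :: alternating j i n' else [::].

(** On a two-letter alphabet there is only one way to avoid repetitions. *)
Lemma alt_of_path i j t : {subset t <= [:: i; j]} ->
  path (fun k l => k != l) j t -> t = alternating i j (size t).
Proof.
elim: t i j => [//|k t IHt] i j tij /= /andP[jk kt].
have ki : k = i.
  have := tij k; rewrite !inE eqxx => /(_ isT) /orP[/eqP//|/eqP kj].
  by rewrite kj eqxx in jk.
rewrite ki in kt *; congr cons; apply: IHt => // l lt.
by have := tij l; rewrite !inE lt orbT => /(_ isT); rewrite orbC.
Qed.

(** Two equal neighbours would cancel and shorten the word; that s_i does not
shorten it excludes i as first letter of t in the same way. *)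
Lemma reduced_path i t : weyl_length (word D (rev t)) = size t ->
  (weyl_length (word D (rev t)) <= weyl_length (word D (rev t) * simple D i)%g)%N ->
  path (fun k l => k != l) i t.
Proof.
elim: t i => [//|k t IHt] i /=; rewrite rev_cons word_rcons => lt le.
have lt' : weyl_length (word D (rev t)) = size t.
  have := length_word D (rev t); have := length_word D [:: k].
  have := length_mul (word D (rev t)) (simple D k).
  by rewrite lt size_rev word1 /=; lia.
apply/andP; split; last by apply: IHt; rewrite ?lt ?lt'.
apply/eqP => ik; move: le; rewrite ik -mulgA simpleK mulg1 lt lt'.
by rewrite ltnn.
Qed.

Definition qcomb i j (x y : int) : Q :=
  [ffun k => x * (k == i)%:R + y * (k == j)%:R].

Lemma qcombC i j x y : qcomb i j x y = qcomb j i y x.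
Proof. by apply/ffunP => k; rewrite !ffunE addrC. Qed.

Lemma qrefl_qcomb i j x y : i != j ->
  qrefl A i (qcomb i j x y) = qcomb i j (- x - A j i * y) y.
Proof.
move=> ij; have P : pairing A (qcomb i j x y) i = 2 * x + A j i * y.
  rewrite /pairing (bigD1 i) //= (bigD1 j) 1?eq_sym //= big1 ?addr0; last first.
    by move=> k /andP[ki kj]; rewrite ffunE (negbTE ki) (negbTE kj) !mulr0 addr0 mul0r.
  by rewrite !ffunE !eqxx (negbTE ij) [j == i]eq_sym (negbTE ij) gcm_diag /=; ring.
by apply/ffunP => k; rewrite !ffunE P; ring.
Qed.

Lemma qword_alt i j n b :
  qword A (rev (alternating i j n.+1)) b = qword A (rev (alternating j i n)) (qrefl A i b).
Proof. by rewrite /= rev_cons /qword foldr_rcons. Qed.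

Lemma word_alt i j n :
  word D (rev (alternating i j n.+1)) = (word D (rev (alternating j i n)) * simple D i)%g.
Proof. by rewrite /= rev_cons word_rcons. Qed.

Lemma qcomb_pos i j x y : 0 <= x -> 0 <= y -> qpos (qcomb i j x y).
Proof. by move=> x0 y0 k; rewrite ffunE; lia. Qed.

(** When a_ij a_ji >= 4, the inequality assumed on the coordinates is inherited
after s_i, with the roles of i and j exchanged, and it keeps both coordinates
nonnegative for ever. *)
Lemma alt_pos_infinite n i j x y : i != j -> 4 <= A i j * A j i ->
  0 <= x -> 0 <= y -> 2 * y <= - A j i * x ->
  qpos (qword A (rev (alternating i j n)) (qcomb i j y x)).
Proof.
elim: n i j x y => [|n IHn] i j x y ij A4 x0 y0 xy; first exact: qcomb_pos.
rewrite qword_alt qrefl_qcomb // qcombC; apply: IHn; rewrite 1?eq_sym //.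
- by rewrite mulrC.
- have := gcm_offdiag A ij; have /(gcm_offdiag A) : j != i by rewrite eq_sym.
  nia.
have := gcm_offdiag A ij; have /(gcm_offdiag A) : j != i by rewrite eq_sym.
nia.
Qed.

(** The order of s_i s_j as a function of n = a_ij a_ji < 4. *)
Definition dihedral_order (n : int) : nat :=
  if n == 0 then 2 else if n == 1 then 3 else if n == 2 then 4 else 6.

Lemma gcm_small i j : i != j -> A i j * A j i < 4 ->
  [\/ A i j = 0 /\ A j i = 0, A i j = -1 /\ A j i = -1,
      (A i j = -1 /\ A j i = -2) \/ (A i j = -2 /\ A j i = -1)
    | (A i j = -1 /\ A j i = -3) \/ (A i j = -3 /\ A j i = -1)].
Proof.
move=> ij; have := gcm_offdiag A ij; have /(gcm_offdiag A) : j != i by rewrite eq_sym.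
have := @gcm_zero _ A i j; have := @gcm_zero _ A j i.
move: (A i j) (A j i) => p q zq zp q0 p0 pq.
have [p0'|p1] : p = 0 \/ p <= -1 by lia.
  by apply: Or41; split => //; apply: zp.
have [q0'|q1] : q = 0 \/ q <= -1 by lia.
  by apply: Or41; split => //; apply: zq.
clear zp zq p0 q0.
have p4 : -4 < p by nia.
have q4 : -4 < q by nia.
have [pE|[pE|pE]] : p = -1 \/ p = -2 \/ p = -3 by lia.
all: rewrite {}pE in pq *.
- have [-> | [-> | ->]] : q = -1 \/ q = -2 \/ q = -3 by lia.
  + exact: Or42.
  + by apply: Or43; left.
  + by apply: Or44; left.
- have -> : q = -1 by lia.
  by apply: Or43; right.
- have -> : q = -1 by lia.
  by apply: Or44; right.
Qed.

(** Only words of length at most 5 occur, and their coordinates are computed. *)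
Lemma alt_pos_finite n i j : i != j -> A i j * A j i < 4 ->
  (n < dihedral_order (A i j * A j i))%N ->
  qpos (qword A (rev (alternating j i n)) (sroot i)).
Proof.
move=> ij small; have ji : j != i by rewrite eq_sym.
have step_i n' x y : qword A (rev (alternating i j n'.+1)) (qcomb i j x y) =
    qword A (rev (alternating j i n')) (qcomb i j (- x - A j i * y) y).
  by rewrite qword_alt qrefl_qcomb.
have step_j n' x y : qword A (rev (alternating j i n'.+1)) (qcomb i j x y) =
    qword A (rev (alternating i j n')) (qcomb i j x (- y - A i j * x)).
  by rewrite qword_alt ![qcomb i j x _]qcombC qrefl_qcomb.
have -> : sroot i = qcomb i j 1 0.
  by apply/ffunP => k; rewrite !ffunE mul0r mul1r addr0.
have [] := gcm_small ij small.
- case=> Aij Aji; rewrite Aij Aji; case: n => [|[|n]] // _;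
  rewrite ?(step_i, step_j) ?Aij ?Aji; apply: qcomb_pos; lia.
- case=> Aij Aji; rewrite Aij Aji; case: n => [|[|[|n]]] // _;
  rewrite ?(step_i, step_j) ?Aij ?Aji; apply: qcomb_pos; lia.
- case=> [] [Aij Aji]; rewrite Aij Aji; case: n => [|[|[|[|n]]]] // _;
  rewrite ?(step_i, step_j) ?Aij ?Aji; apply: qcomb_pos; lia.
- case=> [] [Aij Aji]; rewrite Aij Aji; case: n => [|[|[|[|[|[|n]]]]]] // _;
  rewrite ?(step_i, step_j) ?Aij ?Aji; apply: qcomb_pos; lia.
Qed.

Definition lcomb lam i j (x y : R) : V :=
  lam - x *: Defs.root D i - y *: Defs.root D j.

Lemma lcombC lam i j x y : lcomb lam i j x y = lcomb lam j i y x.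
Proof. by rewrite /lcomb addrAC. Qed.

Lemma reflection_lcomb lam i j x y :
  reflection D i (lcomb lam i j x y) =
  lcomb lam i j ((lam (coroot D i) : R) - x - (A i j)%:~R * y) y.
Proof.
rewrite reflectionE.
have -> : (lcomb lam i j x y (coroot D i) : R) =
    (lam (coroot D i) : R) - x * 2 - y * (A i j)%:~R.
  rewrite /lcomb !add_lfunE !opp_lfunE !scale_lfunE !root_coroot gcm_diag.
  by [].
have -> : (lam (coroot D i) : R) - x - (A i j)%:~R * y =
    x + ((lam (coroot D i) : R) - x * 2 - y * (A i j)%:~R) by ring.
by move: (_ - y * _) => z; rewrite /lcomb scalerDl opprD addrA [LHS]addrAC.
Qed.

Lemma weyl_lcomb lam i j x y n :
  word D (rev (alternating i j n.+1)) (lcomb lam i j x y) =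
  word D (rev (alternating j i n)) (lcomb lam i j ((lam (coroot D i) : R) - x - (A i j)%:~R * y) y).
Proof.
rewrite word_alt weyl_mulE -reflection_lcomb; congr (word _ _ _).
by rewrite /= comp_lfun1r.
Qed.

(** Both sides change a functional by a combination of two roots whose
coefficients are explicit. *)
Lemma braid i j : i != j -> A i j * A j i < 4 ->
  let m := dihedral_order (A i j * A j i) in
  word D (rev (alternating j i m)) = word D (rev (alternating i j m)).
Proof.
move=> ij small /=; apply: val_inj; apply/lfunP => lam.
have step0 k l mu : word D (rev (alternating k l 0)) mu = mu.
  by rewrite word_nil weyl_oneE.
have step_i n x y := @weyl_lcomb lam i j x y n.
have step_j n x y : word D (rev (alternating j i n.+1)) (lcomb lam i j x y) =
  word D (rev (alternating i j n)) (lcomb lam i j x ((lam (coroot D j) : R) - y - (A j i)%:~R * x)).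
  by rewrite ![lcomb lam i j x _]lcombC weyl_lcomb.
suff : forall m, m = dihedral_order (A i j * A j i) ->
    word D (rev (alternating j i m)) (lcomb lam i j 0 0) =
    word D (rev (alternating i j m)) (lcomb lam i j 0 0).
  by move/(_ _ erefl); rewrite /lcomb !scale0r !subr0.
have [] := gcm_small ij small.
- case=> Aij Aji m mE;
  have -> : m = 2%N by rewrite mE Aij Aji.
  by rewrite !(step_i, step_j) !step0 Aij Aji; congr (lcomb _ _ _ _ _); ring.
- case=> Aij Aji m mE;
  have -> : m = 3%N by rewrite mE Aij Aji.
  by rewrite !(step_i, step_j) !step0 Aij Aji; congr (lcomb _ _ _ _ _); ring.
- case=> [] [Aij Aji] m mE;
  (have -> : m = 4%N by rewrite mE Aij Aji);
  rewrite !(step_i, step_j) !step0 Aij Aji; congr (lcomb _ _ _ _ _); ring.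
- case=> [] [Aij Aji] m mE;
  (have -> : m = 6%N by rewrite mE Aij Aji);
  rewrite !(step_i, step_j) !step0 Aij Aji; congr (lcomb _ _ _ _ _); ring.
Qed.

Lemma size_alt i j n : size (alternating i j n) = n.
Proof. by elim: n i j => //= n IHn i j; rewrite IHn. Qed.

(** The rightmost letters of an alternating word do not depend on its length. *)
Lemma alt_suffix i j m n : (m <= n)%N ->
  exists s, rev (alternating i j n) = s ++ rev (alternating i j m).
Proof.
elim: m n i j => [|m IHm] [|n] i j // mn; first by exists [::].
  by exists (rev (alternating i j n.+1)); rewrite cats0.
have [s E] := IHm n j i mn; exists s.
by rewrite /= !rev_cons E rcons_cat.
Qed.

Lemma qact_sum w b l : qact w b l = \sum_i b i * qact w (sroot i) l.
Proof.
suff -> : qact w b = [ffun l => \sum_i b i * qact w (sroot i) l] by rewrite ffunE.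
apply: (@ev_inj _ _ _ _ D) => lam; rewrite -[in LHS](weylVK w lam) ev_qact.
transitivity (\sum_i (b i)%:~R * ev D lam (qact w (sroot i))).
  apply: eq_bigr => i _; congr (_ * _).
  by rewrite -ev_sroot -(ev_qact w) weylVK.
rewrite /ev; under eq_bigr do rewrite mulr_sumr.
rewrite exchange_big /=; apply: eq_bigr => k _.
rewrite ffunE rmorph_sum mulr_suml; apply: eq_bigr => i _.
by rewrite mulrA rmorphM.
Qed.

Lemma qact_qcomb w i j x y l : qact w (qcomb i j x y) l =
  x * qact w (sroot i) l + y * qact w (sroot j) l.
Proof.
have delta (F : I -> int) k z : \sum_m z * (m == k)%:R * F m = z * F k.
  rewrite (bigD1 k) //= big1 ?addr0 ?eqxx ?mulr1 // => m /negbTE->.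
  by rewrite mulr0 mul0r.
rewrite qact_sum; under eq_bigr do rewrite ffunE mulrDl.
by rewrite big_split /= !delta.
Qed.

(** Induction on the length of w.  Let j be the last letter of a reduced word of
w, and among the reduced words s1 ++ s2 of w in which s2 uses only the letters i
and j choose one with s1 as short as possible.  Then neither s_i nor s_j shortens
s1, so by induction s1 maps both simple coroots to nonnegative combinations.  And
s2 is alternating and ends with j, so that it maps the i-th simple coroot to a
nonnegative combination of these two, by the rank two computations. *)
Lemma length_le_pos w i :
  (weyl_length w <= weyl_length (w * simple D i)%g)%N -> qpos (qact w (sroot i)).
Proof.
have [n] := ubnP (weyl_length w); elim: n w i => [//|n IHn] w i.
rewrite ltnS => wn le.
have [w0|w_gt0] := posnP (weyl_length w).
  by rewrite (length_eq0 w0) qact1 => k; rewrite ffunE; case: eqP.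
have [s [ws ss]] := reduced_exists w.
case/lastP: s ws ss => [|s j] ws ss; first by rewrite -ss in w_gt0.
pose P m := `[< exists s1 s2, [/\ reduced_word w (s1 ++ s2), size s1 = m,
   {subset s2 <= [:: j; i]} & (0 < size s2)%N] >].
have exP : exists m, P m.
  exists (size s); apply/asboolP; exists s, [:: j]; split => //.
    by split; rewrite cats1.
  by move=> k; rewrite !inE => ->.
case: (ex_minnP exP) => m /asboolP[s1 [s2 [[ws12 ss12] s1m s2ij s2_gt0]]] min {exP}.
rewrite size_cat in ss12; rewrite word_cat in ws12.
have l1 : weyl_length (word D s1) = size s1.
  have := length_word D s1; have := length_word D s2.
  have := length_mul (word D s1) (word D s2); rewrite ws12; lia.
have l2 : weyl_length (word D s2) = size s2.
  have := length_word D s1; have := length_word D s2.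
  have := length_mul (word D s1) (word D s2); rewrite ws12; lia.
have s1_pos k : k \in [:: j; i] -> qpos (qact (word D s1) (sroot k)).
  move=> kij; apply: IHn; first by rewrite l1; lia.
  rewrite leqNgt; apply/negP => lt.
  have [t [wt st]] := reduced_exists (word D s1 * simple D k)%g.
  have : (m <= size t)%N.
    apply: min; apply/asboolP; exists t, (k :: s2); split=> //.
      have wE : word D (t ++ k :: s2) = w.
        by rewrite word_cat wt word_cons -mulgA (mulgA (simple D k)) simpleK mul1g.
      split=> //; have := length_word D (t ++ k :: s2); rewrite wE !size_cat /=; lia.
    by move=> l; rewrite inE => /orP[/eqP-> //|/s2ij].
  by move: lt; rewrite l1 -st s1m; lia.
have l2i : (weyl_length (word D s2) <= weyl_length (word D s2 * simple D i)%g)%N.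
  have := length_mul (word D s1) (word D s2 * simple D i)%g; rewrite mulgA ws12.
  by move/(leq_trans le); rewrite -ss12 l1 l2 leq_add2l.
have s2alt : s2 = rev (alternating j i (size s2)).
  rewrite -{1}(revK s2); congr rev; rewrite -[in RHS]size_rev; apply: alt_of_path.
    by move=> k; rewrite mem_rev => /s2ij.
  by apply: reduced_path; rewrite revK ?size_rev.
have ij : i != j.
  apply/eqP => ij; move: le; rewrite -{2}ws -ij word_rcons -mulgA simpleK mulg1 -ss size_rcons.
  by have := length_word D s; lia.
have n_small : A i j * A j i < 4 -> (size s2 < dihedral_order (A i j * A j i))%N.
  move=> small; rewrite ltnNge; apply/negP => n_ge.
  (* by the braid relation s2 could be replaced by a word ending with i, so that s_i
     would shorten it *)
  have [s3 s3E] := alt_suffix j i n_ge.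
  have s3sz : (size s3 + dihedral_order (A i j * A j i) = size s2)%N.
    by have := congr1 size s2alt; rewrite s3E size_cat !size_rev !size_alt.
  have braid_ij := braid ij small.
  have [d dE] : exists d, dihedral_order (A i j * A j i) = d.+1.
    by rewrite /dihedral_order; do 3?[case: ifP => _]; eexists.
  move: l2i; rewrite leqNgt => /negP; apply.
  have -> : (word D s2 * simple D i = word D (s3 ++ rev (alternating j i d)))%g.
    rewrite {1}s2alt s3E !word_cat /= braid_ij dE word_alt.
    by rewrite -!mulgA simpleK mulg1.
  rewrite l2 -s3sz dE addnS ltnS (leq_trans (length_word _ _)) //.
  by rewrite size_cat size_rev size_alt.
have s2_pos : qpos (qword A s2 (sroot i)).
  rewrite s2alt; have [small|large] := ltP (A i j * A j i) 4.
    by apply: alt_pos_finite => //; exact: n_small.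
  have -> : sroot i = qcomb j i 0 1.
    by apply/ffunP => k; rewrite !ffunE mul0r mul1r add0r.
  apply: alt_pos_infinite; [by rewrite eq_sym|by rewrite mulrC|by []|by []|].
  by have := gcm_offdiag A ij; lia.
rewrite -ws12 qact_mul (qact_word D s2) => k.
have -> : qword A s2 (sroot i) = qcomb i j (qword A s2 (sroot i) i) (qword A s2 (sroot i) j).
  apply/ffunP => l; rewrite ffunE.
  have [->|li] := eqVneq l i; first by rewrite (negbTE ij) mulr1 mulr0 addr0.
  have [->|lj] := eqVneq l j; first by rewrite mulr1 mulr0 add0r.
  rewrite !mulr0 addr0 -(qact_word D) (@qact_parabolic_notin _ _ _ _ _ [set i; j]).
  - by rewrite ffunE (negbTE li).
  - by exists s2 => // x /s2ij; rewrite !inE orbC.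
  - by rewrite !inE (negbTE li) (negbTE lj).
rewrite qact_qcomb; apply: addr_ge0; apply: mulr_ge0.
- exact: s2_pos.
- by apply: s1_pos; rewrite !inE eqxx orbT.
- exact: s2_pos.
- by apply: s1_pos; rewrite !inE eqxx.
Qed.

End Positivity.

(** * Real coroots and the Tits cone *)

Section RealRoots.
Context (R : realType) (I : finType) (A : gcm I) (h : vectType R).
Context (D : minimal_realization A h).
Local Notation V := 'Hom(h, R^o).
Local Notation Q := {ffun I -> int}.
Implicit Types (lam mu : V) (b c : Q) (w v u : weyl D) (i j k : I) (J K : {set I}).

Definition real_coroot_in J b :=
  exists w i, [/\ parabolic (D := D) J w, i \in J & b = qact w (sroot i)].

Definition real_coroot b := exists w i, b = qact (D := D) w (sroot i).

Lemma real_coroot_inW J b : real_coroot_in J b -> real_coroot b.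
Proof. by move=> [w [i [_ _ ->]]]; exists w, i. Qed.

Lemma real_coroot_simple i : real_coroot (sroot i).
Proof. by exists 1%g, i; rewrite qact1. Qed.

Lemma real_coroot_qact w b : real_coroot b -> real_coroot (qact w b).
Proof. by move=> [v [i ->]]; exists (w * v)%g, i; rewrite qact_mul. Qed.

Lemma real_coroot_in_qact J w b :
  parabolic J w -> real_coroot_in J b -> real_coroot_in J (qact w b).
Proof.
move=> Jw [v [i [Jv iJ ->]]]; exists (w * v)%g, i; rewrite qact_mul; split=> //.
exact: parabolicM.
Qed.

Lemma real_coroot_neq0 b : real_coroot b -> b <> 0.
Proof. by move=> [w [i ->]] /qact_eq0; exact: sroot_neq0. Qed.

Lemma qpos_sroot i : qpos (sroot i).
Proof. by move=> j; rewrite ffunE ler0n. Qed.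

Lemma qpos_antisym b : qpos b -> qpos (- b) -> b = 0.
Proof.
move=> b0 b1; apply/ffunP => i; apply/eqP; have := b1 i.
by rewrite !ffunE oppr_ge0 eq_le b0 andbT.
Qed.

Lemma length_lt_neg w i :
  (weyl_length (w * simple D i)%g < weyl_length w)%N -> qpos (- qact w (sroot i)).
Proof.
move=> lt; rewrite -qact_mulr_simple; apply: length_le_pos.
by rewrite -mulgA simpleK mulg1 ltnW.
Qed.

Lemma real_coroot_sign b : real_coroot b -> qpos b \/ qpos (- b).
Proof.
move=> [w [i ->]]; case: (leqP (weyl_length w) (weyl_length (w * simple D i)%g)).
  by left; exact: length_le_pos.
by right; exact: length_lt_neg.
Qed.

Lemma neg_length_lt w i : qpos (- qact w (sroot i)) ->
  (weyl_length (w * simple D i)%g < weyl_length w)%N.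
Proof.
move=> p; rewrite ltnNge; apply/negP => /length_le_pos /qpos_antisym /(_ p).
by apply: real_coroot_neq0; exists w, i.
Qed.

Lemma real_coroot_pos b j : real_coroot b -> 0 < b j -> qpos b.
Proof.
by move=> /real_coroot_sign[//|/(_ j)]; rewrite ffunE oppr_ge0 leNgt => /negP.
Qed.

(** The elements of the Weyl group have integer matrices in both directions, so
the coefficient of the multiple is invertible in the integers. *)
Lemma real_coroot_multiple b i : real_coroot b -> qpos b -> (forall l, l != i -> b l = 0) ->
  b = sroot i.
Proof.
move=> [w [j bE]] b0 bl.
have E l : sroot j l = b i * qact w^-1%g (sroot i) l.
  rewrite -(qactK w (sroot j)) -bE qact_sum (bigD1 i) //= big1 ?addr0 // => k ki.
  by rewrite bl // mul0r.
have bi1 : b i = 1.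
  have : 1 = b i * qact w^-1%g (sroot i) j by rewrite -E ffunE eqxx.
  move: (qact _ _ _) (b i) (b0 i) => x y y0 yx.
  have x1 : 1 <= x by nia.
  nia.
apply/ffunP => l; rewrite ffunE; have [->|/bl//] := eqVneq l i.
by rewrite bi1.
Qed.

(** The reflection s_i changes only the i-th coordinate, so a positive coordinate
elsewhere survives; and the coordinates of a real coroot have one sign. *)
Lemma qrefl_pos i b : real_coroot b -> qpos b -> b <> sroot i -> qpos (qrefl A i b).
Proof.
move=> rb b0 bi; have [l li bl] : exists2 l, l != i & b l != 0.
  apply: contra_notP bi => nex; apply: real_coroot_multiple => // l li; apply/eqP.
  by apply: contra_notT nex => bl; exists l.
apply: (@real_coroot_pos _ l); first by rewrite -(qact_simple D); exact: real_coroot_qact.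
by rewrite qrefl_neq // lt_def bl b0.
Qed.

(** Apply the letters of a word of w to b one after the other.  By [qrefl_pos] the
sign can change only at a letter i at which b has become the i-th simple coroot,
which leaves one candidate for each letter. *)
Lemma inversions_finite w : exists L : seq Q, forall b, real_coroot b -> qpos b ->
  qpos (- qact w b) -> b \in L.
Proof.
have [s [<- _]] := reduced_exists w.
elim/last_ind: s => [|s i [L HL]].
  exists [::] => b rb b0; rewrite word_nil qact1 => /(qpos_antisym b0).
  by move/(real_coroot_neq0 rb).
exists (sroot i :: map (qrefl A i) L) => b rb b0 neg.
have [->|/eqP bi] := eqVneq b (sroot i); first by rewrite inE eqxx.
rewrite inE; apply/orP; right; apply/mapP; exists (qrefl A i b).
  apply: HL; first by rewrite -(qact_simple D); exact: real_coroot_qact.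
    exact: qrefl_pos.
  by move: neg; rewrite word_rcons qact_mul qact_simple.
by rewrite -!(qact_simple D) -qact_mul simpleK qact1.
Qed.

Lemma ev_ge0 lam b : dominant D lam -> qpos b -> 0 <= ev D lam b.
Proof. by move=> dom b0; apply: sumr_ge0 => i _; rewrite mulr_ge0 // ler0z. Qed.

Lemma ev_le0 lam b : dominant D lam -> qpos (- b) -> ev D lam b <= 0.
Proof. by move=> dom b0; rewrite -oppr_ge0 -evN ev_ge0. Qed.

Definition zeros lam : {set I} := [set i | (lam (coroot D i) : R) == 0].

Lemma descent w : w <> 1%g -> exists i, qpos (- qact w (sroot i)).
Proof.
move=> w1; have [s [ws ss]] := reduced_exists w.
case/lastP: s ws ss => [|s i] ws ss; first by case: w1; rewrite -ws word_nil.
exists i; apply: length_lt_neg; rewrite -ss -{1}ws word_rcons -mulgA simpleK mulg1.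
by rewrite size_rcons ltnS length_word.
Qed.

(** At a descent i of w the coroot w h_i is negative, so lam(h_i), which is the
value of w lam on it, is both nonnegative and nonpositive: s_i fixes lam, and
w s_i is shorter. *)
Lemma dominant_unique w lam : dominant D lam -> dominant D (w lam) ->
  w lam = lam /\ parabolic (zeros lam) w.
Proof.
have [n] := ubnP (weyl_length w); elim: n w => [//|n IHn] w.
rewrite ltnS => wn dom wdom.
have [->|w1] := pselect (w = 1%g); first by rewrite weyl_oneE; split=> //; exact: parabolic1.
have [i neg] := descent w1; have lt := neg_length_lt neg.
have li : (lam (coroot D i) : R) = 0.
  apply/eqP; rewrite eq_le dom andbT -ev_sroot -(ev_qact w).
  exact: ev_le0.
have fix_i : simple D i lam = lam.
  by rewrite /= comp_lfun1r reflectionE li scale0r subr0.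
have := IHn (w * simple D i)%g (leq_trans lt wn); rewrite weyl_mulE fix_i.
case=> // -> Jw; split=> //; rewrite -[w]mulg1 -(simpleK D i) mulgA.
by apply: parabolicM => //; apply: parabolic_simple; rewrite inE li.
Qed.

(** Applying s_i, where lam(h_i) < 0, removes h_i from the list of the positive
coroots on which lam is negative and permutes the others. *)
Lemma dominantize J lam (L : seq Q) :
  (forall b, real_coroot_in J b -> qpos b -> ev D lam b < 0 -> b \in L) ->
  exists2 u : weyl D, parabolic J u & forall j, j \in J -> 0 <= (u lam (coroot D j) : R).
Proof.
have [n] := ubnP (size L); elim: n L lam => [//|n IHn] L lam.
rewrite ltnS => Ln HL.
have [dom|] := pselect (forall j, j \in J -> 0 <= (lam (coroot D j) : R)).
  by exists 1%g; [exact: parabolic1|move=> j; rewrite weyl_oneE; exact: dom].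
move/existsNP => [i /not_implyP[iJ /negP]]; rewrite -ltNge => li.
have iL : sroot i \in L.
  apply: HL; [|exact: qpos_sroot|by rewrite ev_sroot].
  by exists 1%g, i; rewrite qact1; split=> //; exact: parabolic1.
have [] := IHn (map (qrefl A i) (rem (sroot i) L)) (simple D i lam).
- by rewrite size_map size_rem // prednK //; case: (L) iL.
- move=> b rb b0; rewrite evV simpleV qact_simple => neg.
  apply/mapP; exists (qrefl A i b); last by rewrite -!(qact_simple D) -qact_mul simpleK qact1.
  have bi : b <> sroot i.
    by move=> bi; move: neg; rewrite bi qrefl_sroot evN ev_sroot oppr_lt0 ltNge ltW.
  have : qrefl A i b \in L.
    apply: HL => //; last by apply: qrefl_pos => //; exact: real_coroot_inW rb.
    by rewrite -(qact_simple D); apply: real_coroot_in_qact => //; exact: parabolic_simple.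
  rewrite (perm_mem (perm_to_rem iL)) inE => /orP[/eqP E|//].
  have := b0 i; rewrite -(qactK (simple D i) b) qact_simple E simpleV qact_simple.
  by rewrite qrefl_sroot !ffunE eqxx.
move=> u Ju udom; exists (u * simple D i)%g.
  by apply: parabolicM => //; exact: parabolic_simple.
by move=> j; rewrite weyl_mulE; exact: udom.
Qed.

Lemma tits_finite lam : tits_cone D lam ->
  exists L : seq Q, forall b, real_coroot b -> qpos b -> ev D lam b < 0 -> b \in L.
Proof.
move=> [w [mu [dom ->]]]; have [L HL] := inversions_finite w^-1%g.
exists L => b rb b0; rewrite evV => neg; apply: HL => //.
have [p|//] := real_coroot_sign (real_coroot_qact w^-1%g rb).
by move: neg; rewrite ltNge ev_ge0.
Qed.

(** Together with [tits_finite] this describes the Tits cone as the set of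
functionals that are negative on finitely many positive real coroots only; its
convexity follows. *)
Lemma finite_tits lam (L : seq Q) :
  (forall b, real_coroot b -> qpos b -> ev D lam b < 0 -> b \in L) -> tits_cone D lam.
Proof.
move=> HL; have [] := @dominantize [set: I] lam L; first by move=> b /real_coroot_inW; exact: HL.
move=> u _ udom; exists u^-1%g, (u lam); split; last by rewrite weylK.
by move=> i; apply: udom; rewrite finset.in_setT.
Qed.

Lemma tits_coneD lam mu : tits_cone D lam -> tits_cone D mu -> tits_cone D (lam + mu).
Proof.
move=> /tits_finite[L HL] /tits_finite[M HM]; apply: (@finite_tits _ (L ++ M)).
move=> b rb b0; rewrite ev_linD mem_cat => neg.
have [lb|lb] := ltP (ev D lam b) 0; first by rewrite HL.
by rewrite HM ?orbT //; lra.
Qed.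

Lemma dominant_tits lam : dominant D lam -> tits_cone D lam.
Proof. by move=> dom; exists 1%g, lam; rewrite weyl_oneE. Qed.

Lemma tits_dominantize J lam : tits_cone D lam ->
  exists2 u : weyl D, parabolic J u & forall j, j \in J -> 0 <= (u lam (coroot D j) : R).
Proof.
by move=> /tits_finite[L HL]; apply: (@dominantize J lam L) => b /real_coroot_inW; exact: HL.
Qed.

End RealRoots.

(** * A criterion for finite type *)

Section FiniteType.
Context (R : realType) (I : finType) (A : gcm I).
Context (symA : symmetrizable R A).
Implicit Types (i j k l : I) (J K Theta : {set I}) (f u v : I -> R).

(** The entries a_ij and a_ji have the same sign, so the absolute values of the
given coefficients symmetrize as well. *)
Lemma symmetrizable_pos : exists2 d : I -> R, (forall i, 0 < d i) &
  forall i j, d i * (A i j)%:~R = d j * (A j i)%:~R.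
Proof.
have [d d0 dA] := symA; exists (fun i => `|d i|) => [i|i j]; first by rewrite normr_gt0.
have [->//|ij] := eqVneq i j; have ji : j != i by rewrite eq_sym.
have := congr1 Num.norm (dA i j); rewrite !normrM.
rewrite [`|(A i j)%:~R|]ler0_norm ?[`|(A j i)%:~R|]ler0_norm ?lerz0 ?gcm_offdiag //.
by rewrite !mulrN => /oppr_inj.
Qed.

Definition dynkin_edge J : rel I := fun a b => [&& a \in J, b \in J & A a b != 0].

Lemma dynkin_edge_sym J a b : dynkin_edge J a b = dynkin_edge J b a.
Proof.
rewrite /dynkin_edge andbCA; congr [&& _, _ & _].
by apply/idP/idP; apply: contra_neq; exact: gcm_zero.
Qed.

Lemma componentE J i k : (k \in component A J i) = connect (dynkin_edge J) i k.
Proof. by rewrite inE. Qed.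

Lemma component_id J i : i \in component A J i.
Proof. by rewrite componentE connect0. Qed.

Lemma connect_dynkin_sym J a b : connect (dynkin_edge J) a b = connect (dynkin_edge J) b a.
Proof. by apply: sym_connect_sym => c e; rewrite dynkin_edge_sym. Qed.

Lemma component_sub J i : i \in J -> component A J i \subset J.
Proof.
move=> iJ; apply/fintype.subsetP => k; rewrite componentE => /connectP[p].
elim/last_ind: p => [_ -> //|p m _]; rewrite rcons_path last_rcons.
by move=> /andP[_ /and3P[_ + _]] ->.
Qed.

Lemma component_adj J i k l : i \in J -> k \in component A J i -> l \in J -> A k l != 0 ->
  l \in component A J i.
Proof.
move=> iJ ik lJ kl; have kJ := fintype.subsetP (component_sub iJ) k ik.
move: ik; rewrite !componentE => /connect_trans; apply; apply: connect1.
by rewrite /dynkin_edge lJ kl kJ.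
Qed.

(** A property that spreads along the edges of a component holds everywhere on
it as soon as it holds somewhere. *)
Lemma component_connected J i (P : I -> Prop) k : i \in J ->
  k \in component A J i -> P k ->
  (forall a b, a \in component A J i -> b \in component A J i -> P a -> A a b != 0 -> P b) ->
  forall l, l \in component A J i -> P l.
Proof.
move=> iJ ik Pk step l il.
have : connect (dynkin_edge J) k l.
  move: il; rewrite componentE; apply: connect_trans.
  by rewrite connect_dynkin_sym -componentE.
case/connectP => p; elim: p k ik Pk => [|m p IHp] k ik Pk /=; first by move=> _ ->.
move=> /andP[/and3P[kJ mJ km] pm] lE.
have im : m \in component A J i by exact: component_adj km.
by apply: (IHp m) => //; exact: step km.
Qed.

Section Component.
Context (J : {set I}) (i0 : I) (i0J : i0 \in J).
Local Notation K := (component A J i0).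

Definition cartan_mul f k : R := \sum_(l in K) (A k l)%:~R * f l.

(** At a zero of f the image of f is a sum of nonpositive terms, so f vanishes at
all neighbours of this zero too. *)
Lemma cartan_mul_zero f k : (forall l, l \in K -> 0 <= f l) ->
  (forall l, l \in K -> 0 <= cartan_mul f l) -> k \in K -> f k = 0 ->
  forall l, l \in K -> f l = 0.
Proof.
move=> f0 Mf0 kK fk; apply: (component_connected i0J kK fk) => a b aK bK fa ab.
have [<-//|ba] := eqVneq a b.
have := Mf0 a aK; rewrite /cartan_mul (bigD1 a) //= fa mulr0 add0r => s0.
have t0 l : (l \in K) && (l != a) -> (A a l)%:~R * f l <= 0.
  move=> /andP[lK la]; rewrite mulr_le0_ge0 ?f0 // lerz0 gcm_offdiag //.
  by rewrite eq_sym.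
have : (A a b)%:~R * f b = 0.
  apply/eqP; rewrite eq_le t0 ?bK ?[b == a]eq_sym //=.
  apply: le_trans s0 _; rewrite (bigD1 b) /= ?bK ?[b == a]eq_sym //.
  rewrite gerDl sumr_le0 // => l /andP[lK _]; exact: t0.
by move/eqP; rewrite mulf_eq0 intr_eq0 (negbTE ab) => /eqP.
Qed.

Lemma cartan_mulB f g (m : R) k :
  cartan_mul (fun l => f l - m * g l) k = cartan_mul f k - m * cartan_mul g k.
Proof.
rewrite /cartan_mul mulr_sumr -sumrB; apply: eq_bigr => l _; ring.
Qed.

Context (u : I -> R) (u0 : forall k, k \in K -> 0 <= u k).
Context (Mu0 : forall k, k \in K -> 0 <= cartan_mul u k).
Context (k1 : I) (k1K : k1 \in K) (Mu1 : cartan_mul u k1 != 0).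

Lemma witness_gt0 k : k \in K -> 0 < u k.
Proof.
move=> kK; rewrite lt_def u0 // andbT; apply/eqP => uk.
move: Mu1; rewrite /cartan_mul big1 ?eqxx // => l lK.
by rewrite (cartan_mul_zero u0 Mu0 kK uk) ?mulr0.
Qed.

(** Let m be the least ratio of v to u.  If m is not positive, then v - m u is
nonnegative with nonnegative image and has a zero, so v = m u, and m = 0. *)
Lemma cartan_mul_monotone v : (forall k, k \in K -> 0 <= cartan_mul v k) ->
  (forall k, k \in K -> 0 < v k) \/ (forall k, k \in K -> v k = 0).
Proof.
move=> Mv0; have i0K := component_id J i0.
pose k0 := [arg min_(k < i0 | k \in K) (v k / u k)]%O.
have [k0K min] : k0 \in K /\ forall k, k \in K -> v k0 / u k0 <= v k / u k.
  by rewrite /k0; case: Order.TotalTheory.arg_minP.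
set m := v k0 / u k0 in min.
have [m0|m0] := ltP 0 m.
  left=> k kK; have := lt_le_trans m0 (min k kK).
  by rewrite pmulr_lgt0 // invr_gt0 witness_gt0.
right; have z0 : forall k, k \in K -> v k - m * u k = 0.
  apply: (@cartan_mul_zero _ k0) => // [k kK|k kK|].
  - by rewrite subr_ge0 -ler_pdivlMr ?witness_gt0 // min.
  - rewrite cartan_mulB subr_ge0 (le_trans _ (Mv0 k kK)) // mulr_le0_ge0 //.
    exact: Mu0.
  - by rewrite /m divfK ?subrr // gt_eqF // witness_gt0.
have : 0 <= m * cartan_mul u k1.
  have := Mv0 k1 k1K; rewrite (_ : cartan_mul v k1 = m * cartan_mul u k1) //.
  by apply/eqP; rewrite -subr_eq0 -cartan_mulB /cartan_mul big1 // => l lK; rewrite z0 // mulr0.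
have Mu1' : 0 < cartan_mul u k1 by rewrite lt_def Mu1 Mu0.
rewrite pmulr_lge0 // => m0'; have mE : m = 0 by apply/eqP; rewrite eq_le m0 m0'.
by move=> k kK; have := z0 k kK; rewrite mE mul0r subr0.
Qed.

Lemma submx_mul f (i : 'I_#|K|) :
  (gcm_submx R A K *m (\col_j f (enum_val j))) i 0 = cartan_mul f (enum_val i).
Proof.
rewrite /cartan_mul big_enum_val mxE; apply: eq_bigr => j _; by rewrite !mxE.
Qed.

Lemma col_surj (v : 'cV[R]_#|K|) : exists f, v = \col_j f (enum_val j).
Proof.
exists (fun k => v (enum_rank_in (component_id J i0) k) 0).
by apply/matrixP => j z; rewrite mxE enum_valK_in ord1.
Qed.

(** One nonnegative u whose image is nonnegative and not zero suffices: by
[cartan_mul_monotone] the matrix is injective, and the preimage of the vector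
with all entries 1 is positive. *)
Lemma finite_type_criterion : finite_type (gcm_submx R A K).
Proof.
have mono (v : 'cV[R]_#|K|) : (forall i : 'I_#|K|, 0 <= (gcm_submx R A K *m v) i 0) ->
    (forall i : 'I_#|K|, 0 < v i 0) \/ v = 0.
  have [f ->] := col_surj v => Mf.
  have Mf' k : k \in K -> 0 <= cartan_mul f k.
    by move=> kK; have := Mf (enum_rank_in (component_id J i0) k); rewrite submx_mul enum_rankK_in.
  case: (cartan_mul_monotone Mf') => H; [left=> i|right].
    by rewrite mxE H // enum_valP.
  by apply/matrixP => i j; rewrite !mxE H // enum_valP.
have ker0 (v : 'cV[R]_#|K|) : gcm_submx R A K *m v = 0 -> v = 0.
  move=> Mv; case: (mono v) => [i|pv|//]; first by rewrite Mv mxE.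
  case: (mono (- v)) => [i|nv|/eqP]; first by rewrite mulmxN Mv oppr0 mxE.
    apply/matrixP => i j; rewrite ord1 mxE; have := nv i; have := pv i.
    by rewrite mxE; lra.
  by rewrite oppr_eq0 => /eqP.
have det : \det (gcm_submx R A K) != 0.
  rewrite -det_tr; apply/det0P => -[v v0 /(congr1 trmx)].
  rewrite trmx_mul trmxK trmx0 => /ker0 /(congr1 trmx); rewrite trmxK trmx0 => vE.
  by rewrite vE eqxx in v0.
split=> //; have Munit : gcm_submx R A K \in unitmx by rewrite unitmxE unitfE.
pose v : 'cV[R]_#|K| := invmx (gcm_submx R A K) *m const_mx 1.
have Mv : gcm_submx R A K *m v = const_mx 1 by rewrite mulKVmx.
exists v; split=> [|i]; last by rewrite Mv mxE.
case: (mono v) => [j|//|v0]; first by rewrite Mv mxE.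
move=> i; have := congr1 (fun m : 'cV_ _ => m i 0) Mv.
by rewrite v0 mulmx0 !mxE => /eqP; rewrite eq_sym oner_eq0.
Qed.

End Component.

End FiniteType.

(** * Finite type and finiteness of the set of coroots *)

Section FiniteCoroots.
Context (R : realType) (I : finType) (A : gcm I) (h : vectType R).
Context (symA : symmetrizable R A) (D : minimal_realization A h).
Local Notation V := 'Hom(h, R^o).
Local Notation Q := {ffun I -> int}.
Implicit Types (lam mu : V) (b c : Q) (w v u : weyl D) (i j k l : I) (J K : {set I}).

(** The criterion for the transposed matrix; dividing c by the symmetrizing
coefficients leads back to the matrix itself. *)
Lemma finite_type_of_coroot J i0 (c : I -> R) : i0 \in J ->
  (forall k, k \in component A J i0 -> 0 <= c k) ->
  (forall k, k \in component A J i0 ->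
     0 <= \sum_(l in component A J i0) c l * (A l k)%:~R) ->
  (exists2 k, k \in component A J i0 &
     \sum_(l in component A J i0) c l * (A l k)%:~R != 0) ->
  finite_type (gcm_submx R A (component A J i0)).
Proof.
move=> i0J c0 Mc0 [k1 k1K Mc1]; have [d d0 dA] := symmetrizable_pos symA.
pose u l := c l / d l.
have mE k : \sum_(l in component A J i0) c l * (A l k)%:~R = d k * cartan_mul A J i0 u k.
  rewrite /cartan_mul mulr_sumr; apply: eq_bigr => l _.
  by rewrite /u (mulrA (d k)) dA; field; rewrite gt_eqF.
apply: (@finite_type_criterion _ _ _ _ _ i0J u _ _ k1) => //.
- by move=> k kK; rewrite divr_ge0 ?c0 // ltW.
- by move=> k kK; have := Mc0 k kK; rewrite mE pmulr_rge0.
- by move: Mc1; rewrite mE mulf_eq0 negb_or => /andP[].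
Qed.

Lemma finite_type_pos K : finite_type (gcm_submx R A K) ->
  exists2 c : I -> R, (forall k, k \in K -> 0 < c k) &
    forall k, k \in K -> 0 < \sum_(l in K) (A k l)%:~R * c l.
Proof.
have [->|[i0 i0K]] := set_0Vmem K.
  by move=> _; exists (fun=> 0) => k; rewrite inE.
move=> [_ [v [v0 Mv0]] _].
pose c k := v (enum_rank_in i0K k) 0.
exists c => [k kK|k kK]; first exact: v0.
suff <- : (gcm_submx R A K *m v) (enum_rank_in i0K k) 0 =
  \sum_(l in K) (A k l)%:~R * c l by exact: Mv0.
rewrite big_enum_val mxE; apply: eq_bigr => l _.
by rewrite mxE enum_rankK_in // /c enum_valK_in.
Qed.

Section Form.
Context (d : I -> R) (d0 : forall i, 0 < d i).
Context (dA : forall i j, d i * (A i j)%:~R = d j * (A j i)%:~R).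

(** The invariant form lives on the coroots, hence the quotient by d j instead of
the product with d i. *)
Definition gram i j : R := (A i j)%:~R / d j.

Lemma gram_sym i j : gram i j = gram j i.
Proof.
have dn0 k : d k != 0 by rewrite gt_eqF.
by apply/eqP; rewrite /gram eqr_div // mulrC dA mulrC.
Qed.

Definition qform b : R := \sum_k \sum_l gram k l * (b k)%:~R * (b l)%:~R.

Lemma qformE b : qform b = \sum_l (pairing A b l)%:~R / d l * (b l)%:~R.
Proof.
rewrite /qform exchange_big /=; apply: eq_bigr => l _.
rewrite /pairing rmorph_sum !mulr_suml; apply: eq_bigr => k _.
by rewrite rmorphM /gram; ring.
Qed.

Lemma pairing_qrefl i b l :
  pairing A (qrefl A i b) l = pairing A b l - pairing A b i * A i l.
Proof.
rewrite /pairing (eq_bigr (fun k => b k * A k l - (k == i)%:R * pairing A b i * A k l)).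
  rewrite sumrB; congr (_ - _); rewrite (bigD1 i) //= eqxx mul1r big1 ?addr0 //.
  by move=> k /negbTE->; rewrite !mul0r.
by move=> k _; rewrite ffunE; ring.
Qed.

Lemma qform_qrefl i b : qform (qrefl A i b) = qform b.
Proof.
set t : R := (pairing A b i)%:~R.
have tE : \sum_l gram i l * (b l)%:~R = t / d i.
  rewrite /t /pairing rmorph_sum mulr_suml; apply: eq_bigr => l _.
  by rewrite gram_sym /gram rmorphM; ring.
rewrite !qformE.
transitivity (\sum_l ((pairing A b l)%:~R / d l * (b l)%:~R - t * (gram i l * (b l)%:~R)
   - (l == i)%:R * (t / d l * (pairing A (qrefl A i b) l)%:~R))).
  apply: eq_bigr => l _; rewrite {2}/qrefl ffunE pairing_qrefl -/t.
  by rewrite !(rmorphB, rmorphM) /= rmorph_nat -/t /gram; ring.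
rewrite !sumrB -mulr_sumr tE -addrA -[RHS]addr0; congr (_ + _).
rewrite -opprD; apply/eqP; rewrite oppr_eq0; apply/eqP.
rewrite [X in _ + X](bigD1 i) //= eqxx mul1r big1 ?addr0; last first.
  by move=> k /negbTE->; rewrite mul0r.
by rewrite pairing_qrefl gcm_diag rmorphB rmorphM /= -/t; ring.
Qed.

Lemma qform_qact w b : qform (qact w b) = qform b.
Proof.
have [s [<- _]] := reduced_exists w; rewrite qact_word.
by elim: s => //= i s IHs; rewrite qform_qrefl.
Qed.

Lemma qform_sroot i : qform (sroot i) = 2 / d i.
Proof.
rewrite qformE (bigD1 i) //= big1 ?addr0 => [|l li]; rewrite ffunE.
  by rewrite pairing_sroot gcm_diag eqxx mulr1.
by rewrite (negbTE li) mulr0.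
Qed.

(** The off-diagonal entries are nonpositive, so each cross term is bounded below
by the inequality of the arithmetic and geometric means with the weights d k c k;
when the sums over l are positive, the form is positive definite on K. *)
Lemma qform_bound K (c : I -> R) b : (forall k, k \in K -> 0 < c k) ->
  (forall k, k \notin K -> b k = 0) ->
  \sum_(k in K) (\sum_(l in K) (A k l)%:~R * c l) / (d k * c k) * (b k)%:~R ^+ 2 <= qform b.
Proof.
move=> c0 b0; pose p k := d k * c k.
have p0 k : k \in K -> 0 < p k by move=> kK; rewrite mulr_gt0 ?c0.
pose x k : R := (b k)%:~R.
have -> : qform b = \sum_(k in K) \sum_(l in K) gram k l * x k * x l.
  rewrite /qform [RHS]big_mkcond; apply: eq_bigr => k _.
  case: ifPn => [kK|/b0 bk].
    rewrite [RHS]big_mkcond; apply: eq_bigr => l _; case: ifPn => // /b0 bl.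
    by rewrite bl mulr0.
  by rewrite big1 // => l _; rewrite bk mulr0 mul0r.
have -> : \sum_(k in K) (\sum_(l in K) (A k l)%:~R * c l) / (d k * c k) * (b k)%:~R ^+ 2 =
   \sum_(k in K) \sum_(l in K) 2^-1 * gram k l * (x k ^+ 2 * (p l / p k) + x l ^+ 2 * (p k / p l)).
  have half k : k \in K -> \sum_(l in K) gram k l * (x k ^+ 2 * (p l / p k)) =
      (\sum_(l in K) (A k l)%:~R * c l) / (d k * c k) * (b k)%:~R ^+ 2.
    move=> kK; rewrite !mulr_suml; apply: eq_bigr => l _.
    by rewrite /gram /p -/(x k); field; rewrite !gt_eqF ?c0.
  rewrite -(eq_bigr _ half).
  have -> : \sum_(k in K) \sum_(l in K) 2^-1 * gram k l *
       (x k ^+ 2 * (p l / p k) + x l ^+ 2 * (p k / p l)) =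
     2^-1 * (\sum_(k in K) \sum_(l in K) gram k l * (x k ^+ 2 * (p l / p k)))
     + 2^-1 * (\sum_(k in K) \sum_(l in K) gram k l * (x l ^+ 2 * (p k / p l))).
    rewrite -mulrDr -big_split mulr_sumr; apply: eq_bigr => k _ /=.
    rewrite -big_split mulr_sumr; apply: eq_bigr => l _ /=; ring.
  have -> : \sum_(k in K) \sum_(l in K) gram k l * (x l ^+ 2 * (p k / p l)) =
    \sum_(k in K) \sum_(l in K) gram k l * (x k ^+ 2 * (p l / p k)).
    rewrite exchange_big; apply: eq_bigr => k _; apply: eq_bigr => l _.
    by rewrite gram_sym.
  by set s := \sum_(k in K) _; lra.
apply: ler_sum => k kK; apply: ler_sum => l lK.
have [<-|kl] := eqVneq k l.
  by rewrite mulfV ?gt_eqF ?p0 // mulr1 le_eqVlt; apply/orP; left; apply/eqP; field.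
have g0 : gram k l <= 0 by rewrite pmulr_lle0 ?invr_gt0 // lerz0 gcm_offdiag.
move: (gram k l) (p k) (p l) (x k) (x l) g0 (p0 k kK) (p0 l lK) => g pk pl xk xl g0 pk0 pl0.
rewrite -subr_ge0.
have -> : g * xk * xl - 2^-1 * g * (xk ^+ 2 * (pl / pk) + xl ^+ 2 * (pk / pl)) =
  - g * (2^-1 * (pk * pl)) * (xk / pk - xl / pl) ^+ 2.
  by field; rewrite !gt_eqF.
apply: mulr_ge0; last exact: sqr_ge0.
apply: mulr_ge0; first by rewrite oppr_ge0.
by rewrite !mulr_ge0 ?invr_ge0 ?ler0n // ltW.
Qed.

End Form.

(** A real coroot has the same norm as some simple coroot, and the positive
definite form bounds the coordinates of the vectors of given norm. *)
Lemma finite_coroots K : finite_type (gcm_submx R A K) ->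
  exists L : seq Q, forall b, real_coroot_in D K b -> qpos b -> b \in L.
Proof.
move=> /finite_type_pos[c c0 Mc0]; have [d d0 dA] := symmetrizable_pos symA.
pose s k := (\sum_(l in K) (A k l)%:~R * c l) / (d k * c k).
have s0 k : k \in K -> 0 < s k.
  by move=> kK; rewrite divr_gt0 ?Mc0 // mulr_gt0 ?c0.
(* the sum exceeds each bound (2 / d i) / s k for the square of a coordinate *)
pose C : R := \sum_(i in K) \sum_(k in K) 2 / d i / s k.
have t0 m n : m \in K -> n \in K -> 0 <= 2 / d m / s n.
  by move=> mK nK; exact: (divr_ge0 (divr_ge0 (ler0n _ _) (ltW (d0 _))) (ltW (s0 _ nK))).
have C0 : 0 <= C by apply: sumr_ge0 => i iK; apply: sumr_ge0 => k; exact: t0.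
have [N CN] : exists N : nat, C < N%:R by exists (Num.bound C); exact: archi_boundP.
exists [seq [ffun i => (f i : nat)%:Z] | f : {ffun I -> 'I_N.+1}] => b rb b0.
have bN k : b k <= N%:Z.
  move: rb => [w [i [Kw iK bE]]].
  have bK l : l \notin K -> b l = 0.
    move=> lK; rewrite bE (qact_parabolic_notin _ Kw lK) ffunE.
    by case: eqP lK => // ->; rewrite iK.
  have [kK|/bK->//] := boolP (k \in K).
  have := qform_bound d0 dA c0 bK; rewrite bE qform_qact // qform_sroot -bE => le.
  have : (b k)%:~R ^+ 2 <= C.
    apply: (@le_trans _ _ (2 / d i / s k)).
      rewrite ler_pdivlMr ?s0 // mulrC; apply: le_trans le.
      rewrite (bigD1 k) //= lerDl sumr_ge0 // => l /andP[lK _].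
      by rewrite mulr_ge0 ?sqr_ge0 // ltW // s0.
    rewrite /C (bigD1 i) //= (bigD1 k) //= -addrA lerDl addr_ge0 //.
      by apply: sumr_ge0 => l /andP[lK _]; exact: t0.
    apply: sumr_ge0 => m /andP[mK _]; apply: sumr_ge0 => l lK; exact: t0.
  move=> /le_lt_trans/(_ CN); rewrite -rmorphXn -[N%:R]/((N%:Z)%:~R) ltr_int.
  by have := b0 k; nia.
apply/mapP; exists [ffun k => inord `|b k|%N]; rewrite ?mem_enum //.
apply/ffunP => k; rewrite !ffunE inordK; first by rewrite gez0_abs.
by have := bN k; have := b0 k; lia.
Qed.

Lemma finite_dominantize K lam : finite_type (gcm_submx R A K) ->
  exists2 u : weyl D, parabolic K u & forall j, j \in K -> 0 <= (u lam (coroot D j) : R).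
Proof.
move=> /finite_coroots[L HL]; apply: (@dominantize _ _ _ _ _ K lam L) => b rb b0 _.
exact: HL.
Qed.

End FiniteCoroots.

(** * Cosets, facets and faces *)

Section Faces.
Context (R : realType) (I : finType) (A : gcm I) (h : vectType R).
Context (D : minimal_realization A h).
Local Notation V := 'Hom(h, R^o).
Implicit Types (lam mu nu : V) (w v u : weyl D) (i j k l : I) (J K : {set I}) (F G : face D).

(** The representative of the facet of W_J; the coset w W_J is represented by
the point w (facet_point J). *)
Definition facet_point J : V := weight D (fun i => (i \notin J)%:R).

Lemma facet_pointE J i : facet_point J (coroot D i) = (i \notin J)%:R.
Proof. exact: weightE. Qed.

Lemma facet_point_dominant J : dominant D (facet_point J).
Proof. by move=> i; rewrite facet_pointE ler0n. Qed.

Lemma zeros_facet_point J : zeros D (facet_point J) = J.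
Proof.
by apply/setP => i; rewrite inE facet_pointE; case: (i \in J) => /=; rewrite ?eqxx // oner_eq0.
Qed.

Lemma parabolic_facet_point J w : parabolic J w -> w (facet_point J) = facet_point J.
Proof. by move=> Jw; apply: (weyl_parabolic_fix Jw) => j jJ; rewrite facet_pointE jJ. Qed.

Lemma parabolic_facet_pointS J K w :
  J \subset K -> parabolic J w -> w (facet_point K) = facet_point K.
Proof. by move=> JK /(parabolicS JK); exact: parabolic_facet_point. Qed.

Lemma facet_point_fix J w : w (facet_point J) = facet_point J -> parabolic J w.
Proof.
move=> wJ; have [] := @dominant_unique _ _ _ _ D w (facet_point J) (@facet_point_dominant J).
  by rewrite wJ; exact: facet_point_dominant.
by rewrite zeros_facet_point.
Qed.

Lemma parabolic_simple_mem K j : parabolic K (simple D j) -> j \in K.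
Proof.
move=> /parabolic_facet_point; rewrite /= comp_lfun1r reflectionE => /lfunP/(_ (coroot D j)).
rewrite add_lfunE opp_lfunE scale_lfunE root_coroot gcm_diag facet_pointE.
by case: (j \in K) => //=; rewrite /GRing.scale /=; lra.
Qed.

Lemma left_coset_refl w J : left_coset w J w.
Proof. by exists 1%g; rewrite ?mulg1 //; exact: parabolic1. Qed.

Lemma left_cosetP w J v : left_coset w J v <-> parabolic J (w^-1 * v)%g.
Proof.
split=> [[u Ju <-]|Ju]; first by rewrite mulKg.
by exists (w^-1 * v)%g; rewrite ?mulVKg.
Qed.

Lemma left_coset_sub w J v K :
  (left_coset w J `<=` left_coset v K)%classic <-> J \subset K /\ parabolic K (v^-1 * w)%g.
Proof.
split=> [sub|[JK Kvw] u /left_cosetP Ju]; last first.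
  apply/left_cosetP; rewrite -(mulVKg w u) mulgA; apply: parabolicM => //.
  exact: parabolicS Ju.
have /left_cosetP Kvw := sub _ (left_coset_refl w J); split=> //.
apply/fintype.subsetP => j jJ.
have /sub/left_cosetP : left_coset w J (w * simple D j)%g.
  by exists (simple D j) => //; exact: parabolic_simple.
rewrite mulgA => /(parabolicM (parabolicV Kvw)); rewrite mulKg.
exact: parabolic_simple_mem.
Qed.

Lemma cc_coset_eq w J v K :
  cc_coset w J = cc_coset v K <-> J = K /\ parabolic K (v^-1 * w)%g.
Proof.
split=> [/(congr1 (@cc_set _ _ _ _ _)) /= E|[<- Jvw]].
  have [JK Kvw] : J \subset K /\ parabolic K (v^-1 * w)%g by apply/left_coset_sub; rewrite E.
  have [KJ _] : K \subset J /\ parabolic J (w^-1 * v)%g by apply/left_coset_sub; rewrite E.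
  by split=> //; apply/eqP; rewrite finset.eqEsubset JK.
apply: val_inj; apply/seteqP; split; apply/left_coset_sub; split=> //.
by rewrite -[v]invgK -invgM; exact: parabolicV.
Qed.

Lemma cc_cosetP (c : coxeter_complex D) : exists w J, c = cc_coset w J.
Proof.
by case: c => c /[dup] /asboolP[w [J cE]] cP; exists w, J; apply: val_inj.
Qed.

Lemma perturb lam nu : exists2 e : R, 0 < e & forall i,
  0 < (lam (coroot D i) : R) -> 0 < (lam + e *: nu) (coroot D i) :> R.
Proof.
pose t i : R := `|nu (coroot D i) : R| / (lam (coroot D i) : R).
(* 1 / M is smaller than each ratio of lam(h_i) to |nu(h_i)| *)
pose M : R := 1 + \sum_(i | 0 < (lam (coroot D i) : R)) t i.
have t0 i : 0 < (lam (coroot D i) : R) -> 0 <= t i.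
  by move=> l0; rewrite divr_ge0 // ltW.
have M0 : 0 < M by rewrite ltr_pwDl // sumr_ge0.
exists M^-1; rewrite ?invr_gt0 // => i li.
rewrite add_lfunE scale_lfunE /GRing.scale /=.
have tM : t i < M.
  rewrite /M (bigD1 i) //=.
  have : 0 <= \sum_(j | (0 < (lam (coroot D j) : R)) && (j != i)) t j.
    by apply: sumr_ge0 => j /andP[/t0].
  lra.
have : M^-1 * `|nu (coroot D i) : R| < lam (coroot D i).
  by rewrite mulrC ltr_pdivrMr // -ltr_pdivrMl // mulrC.
have := ler_norm (- (nu (coroot D i) : R)); rewrite normrN => n1 n2.
have : M^-1 * - (nu (coroot D i) : R) <= M^-1 * `|nu (coroot D i) : R|.
  by rewrite ler_pM2l ?invr_gt0.
lra.
Qed.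

Lemma dominant_perturb lam nu : dominant D lam ->
  (forall i, lam (coroot D i) = 0 -> 0 <= (nu (coroot D i) : R)) ->
  exists2 e : R, 0 < e & dominant D (lam + e *: nu) /\
    zeros D (lam + e *: nu) = [set i in zeros D lam | (nu (coroot D i) : R) == 0].
Proof.
move=> dom nu0; have [e e0 He] := perturb lam nu; exists e => //.
have E i : lam (coroot D i) = 0 -> (lam + e *: nu) (coroot D i) = e * (nu (coroot D i) : R).
  by move=> li; rewrite add_lfunE scale_lfunE li add0r.
split=> [i|].
  have [li|/eqP li] := eqVneq (lam (coroot D i) : R) 0.
    by rewrite E // mulr_ge0 ?nu0 // ltW.
  by rewrite ltW // He // lt_def dom andbT; apply/eqP.
apply/setP => i; rewrite !inE.
have [li|li] := eqVneq (lam (coroot D i) : R) 0.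
  by rewrite E // mulf_eq0 gt_eqF.
by rewrite gt_eqF // He // lt_def dom li.
Qed.

Lemma conv_mem (t : R) : 0 < t < 1 ->
  exists2 s : {i01 R}, s%:num = t & 0 < s%:num < 1.
Proof.
move=> /[dup] t01 /andP[t0 t1]; exists (Itv01 (ltW t0) (ltW t1)) => //.
Qed.

Lemma face_conv F (x y : V) (t : R) : 0 < t < 1 -> face_set F x -> face_set F y ->
  face_set F (t *: x + (1 - t) *: y).
Proof.
move=> /conv_mem[s <- _] Fx Fy; have := is_face_face F => -[FE|[_ _ cF _]].
  move: Fx Fy; rewrite FE => Xx Xy; apply: tits_coneD;
    apply: tits_coneZ => //; by rewrite ?subr_ge0.
have := cF x y s; rewrite !inE => /(_ Fx Fy); exact.
Qed.

Lemma face_extreme F (x y : V) (t : R) : 0 < t < 1 -> tits_cone D x -> tits_cone D y ->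
  face_set F (t *: x + (1 - t) *: y) -> face_set F x /\ face_set F y.
Proof.
move=> /conv_mem[s <- s01] Xx Xy; have := is_face_face F => -[->//|[_ _ _ eF]] Fxy.
exact: (eF x y s).
Qed.

Lemma face_tits F x : face_set F x -> tits_cone D x.
Proof. exact: (face_sub (is_face_face F)). Qed.

Lemma face_scale F (x : V) (a : R) : 0 <= a -> face_set F x -> face_set F (a *: x).
Proof.
move=> a0 Fx; have F0 := face_has0 (is_face_face F).
have Fb : face_set F ((a + 2) *: x).
  have [] // := @face_extreme F ((a + 2) *: x) 0 (a + 2)^-1.
  - by rewrite invr_gt0 invf_lt1; lra.
  - by apply: tits_coneZ; [lra|exact: face_tits Fx].
  - exact: tits_cone0.
  - by rewrite scaler0 addr0 scalerA mulVf ?scale1r //; apply/eqP; lra.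
have -> : a *: x = (a / (a + 2)) *: ((a + 2) *: x) + (1 - a / (a + 2)) *: 0.
  by rewrite scaler0 addr0 scalerA divfK //; apply/eqP; lra.
have [->|an0] := eqVneq a 0; first by rewrite mul0r scale0r scaler0 addr0.
have a1 : 0 < a by rewrite lt_def an0.
apply: face_conv => //.
apply/andP; split; first by apply: divr_gt0; lra.
by rewrite ltr_pdivrMr; lra.
Qed.

Lemma face_add F (x y : V) : face_set F x -> face_set F y -> face_set F (x + y).
Proof.
move=> Fx Fy; have -> : x + y = 2^-1 *: (2 *: x) + (1 - 2^-1) *: (2 *: y).
  rewrite !scalerA mulVf ?pnatr_eq0 // scale1r (_ : (1 - 2^-1) * 2 = 1 :> R) ?scale1r //.
  by field.
by apply: face_conv; [lra|apply: face_scale..].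
Qed.

Lemma face_summand F (x y : V) : tits_cone D x -> tits_cone D y ->
  face_set F (x + y) -> face_set F x.
Proof.
move=> Xx Xy Fxy; have [] := @face_extreme F (2 *: x) (2 *: y) 2^-1.
- lra.
- exact: tits_coneZ.
- exact: tits_coneZ.
- rewrite !scalerA mulVf ?pnatr_eq0 // scale1r (_ : (1 - 2^-1) * 2 = 1 :> R) ?scale1r //.
  by field.
move=> Fx _; rewrite -[x]scale1r -(mulVf (_ : 2 != 0 :> R)) ?pnatr_eq0 // -scalerA.
by apply: face_scale.
Qed.

(** Of two points of the same open facet, each is up to a positive factor a
summand of the other in the dominant cone; so a face contains both or none. *)
Lemma face_facet F w mu : dominant D mu ->
  face_set F (w mu) <-> face_set F (w (facet_point (zeros D mu))).
Proof.
have main lam nu : dominant D lam -> dominant D nu -> zeros D lam = zeros D nu ->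
    face_set F (w lam) -> face_set F (w nu).
  move=> dl dn E Fl; have [i li|e e0 [dom _]] := @dominant_perturb lam (- nu) dl.
    rewrite opp_lfunE; have : i \in zeros D lam by rewrite inE li.
    by rewrite E inE => /eqP->; rewrite oppr0.
  have : face_set F (e *: w nu).
    apply: (@face_summand _ _ (w (lam + e *: - nu))).
    - by apply: tits_coneZ (ltW e0) _; apply: tits_cone_weyl; exact: dominant_tits.
    - by apply: tits_cone_weyl; exact: dominant_tits.
    - by rewrite scalerN linearB linearZ addrCA subrr addr0.
  move/(face_scale (a := e^-1)); rewrite scalerA mulVf ?gt_eqF // scale1r; apply.
  by rewrite invr_ge0 ltW.
by move=> dom; split; apply: main => //; rewrite ?zeros_facet_point //; exact: facet_point_dominant.
Qed.

(** The sum of the two points lies in the facet of type J :&: K. *)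
Lemma face_facet_pointI F w J K :
  face_set F (w (facet_point J)) -> face_set F (w (facet_point K)) ->
  face_set F (w (facet_point (J :&: K))).
Proof.
move=> FJ FK; have dom : dominant D (facet_point J + facet_point K).
  by move=> i; rewrite add_lfunE !facet_pointE; apply: addr_ge0; rewrite ler0n.
suff <- : zeros D (facet_point J + facet_point K) = J :&: K.
  by apply/(face_facet F w dom); rewrite linearD; exact: face_add.
apply/setP => i; rewrite !inE add_lfunE !facet_pointE.
by rewrite -natrD pnatr_eq0 addn_eq0 !eqb0 !negbK.
Qed.

Lemma face_facet_pointT F w : face_set F (w (facet_point [set: I])).
Proof.
have -> : facet_point [set: I] = 0.
  by rewrite /facet_point /weight big1 // => i _; rewrite finset.in_setT scale0r.
by rewrite linear0; exact: face_has0 (is_face_face F).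
Qed.

End Faces.

(** * The faces attached to special subsets *)

Section SpecialFaces.
Context (R : realType) (I : finType) (A : gcm I) (h : vectType R).
Context (symA : symmetrizable R A) (D : minimal_realization A h).
Local Notation V := 'Hom(h, R^o).
Local Notation Q := {ffun I -> int}.
Implicit Types (lam mu nu x y : V) (b c : Q) (i j k l : I) (J K Theta : {set I}) (F G : face D).

Definition height b : int := \sum_i b i.

Lemma height_qrefl i b : height (qrefl A i b) = height b - pairing A b i.
Proof.
rewrite /height (eq_bigr (fun k => b k - (k == i)%:R * pairing A b i)); last first.
  by move=> k _; rewrite ffunE.
rewrite sumrB; congr (_ - _); rewrite (bigD1 i) //= eqxx mul1r big1 ?addr0 //.
by move=> k /negbTE->; rewrite mul0r.
Qed.

Lemma exists_highest (N : Q -> Prop) (L : seq Q) b0 : (forall b, N b -> b \in L) -> N b0 ->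
  exists2 b, N b & forall b', N b' -> height b' <= height b.
Proof.
elim: L N b0 => [|a L IHL] N b0 NL Nb0; first by have := NL _ Nb0.
have [[b1 [Nb1 b1a]]|nex] := pselect (exists b1, N b1 /\ b1 != a); last first.
  have all_a b : N b -> b = a.
    by move=> Nb; apply/eqP; apply: contra_notT nex => ba; exists b.
  by exists b0 => // b' /all_a->; rewrite (all_a _ Nb0).
have [|b [Nb ba] bmax] := IHL (fun b => N b /\ b != a) b1 _ (conj Nb1 b1a).
  by move=> b [/NL]; rewrite inE => /orP[/eqP->|//]; rewrite eqxx.
have [[Na lt]|nlt] := pselect (N a /\ height b < height a).
  exists a => // b' Nb'; have [->//|b'a] := eqVneq b' a.
  by apply: le_trans (ltW lt); apply: bmax.
exists b => // b' Nb'; have [b'E|b'a] := eqVneq b' a; last exact: bmax.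
by rewrite leNgt; apply: contra_notN nlt; rewrite -b'E.
Qed.

(** A reflection would raise a coroot of greatest height on which alpha_k is
negative. *)
Lemma exists_top K (N : Q -> Prop) (L : seq Q) b0 : (forall b, N b -> b \in L) -> N b0 ->
  (forall b k, k \in K -> N b -> pairing A b k < 0 -> N (qrefl A k b)) ->
  exists2 b, N b & forall k, k \in K -> 0 <= pairing A b k.
Proof.
move=> NL Nb0 Nrefl; have [b Nb bmax] := exists_highest NL Nb0.
exists b => // k kK; rewrite leNgt; apply/negP => neg.
by have := bmax _ (Nrefl b k kK Nb neg); rewrite height_qrefl; lia.
Qed.

Lemma special_infinite Theta k : special R A Theta -> k \in Theta ->
  ~ finite_type (gcm_submx R A (component A Theta k)).
Proof. by move=> spT; rewrite {1}spT inE => /andP[_ /asboolPn]. Qed.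

(** If y(h_i) < 0, then y is negative on every positive coroot of the component K
of i that involves h_i.  As y is in the Tits cone, these are finitely many, and
the highest of them shows that K is of finite type.  Its pairings with the
alpha_k, k in K, are not all zero, since W_K would fix it and it is conjugate to
some h_j. *)
Lemma antidominant_zero Theta y : special R A Theta -> tits_cone D y ->
  (forall i, i \in Theta -> (y (coroot D i) : R) <= 0) ->
  forall i, i \in Theta -> y (coroot D i) = 0.
Proof.
move=> spT Xy y0 i iT; apply/eqP; apply: contra_notT (special_infinite spT iT) => yi.
have yi0 : (y (coroot D i) : R) < 0 by rewrite lt_neqAle yi y0.
set K := component A Theta i; have KT : K \subset Theta by exact: component_sub.
have iK : i \in K by exact: component_id.
pose N b := [/\ real_coroot_in D K b, qpos b & 0 < b i].
have suppK b : real_coroot_in D K b -> forall l, l \notin K -> b l = 0.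
  move=> [w [j [Kw jK ->]]] l lK; rewrite (qact_parabolic_notin _ Kw lK) ffunE.
  by case: eqP lK => // ->; rewrite jK.
have [L HL] := tits_finite Xy.
have NL b : N b -> b \in L.
  move=> [rb b0 bi]; apply: HL => //; first exact: real_coroot_inW rb.
  rewrite /ev (bigD1 i) //=.
  have : (b i)%:~R * (y (coroot D i) : R) < 0 by rewrite pmulr_rlt0 ?ltr0z.
  have : \sum_(l | l != i) (b l)%:~R * (y (coroot D l) : R) <= 0.
    apply: sumr_le0 => l _; have [lK|/(suppK b rb)->] := boolP (l \in K); last by rewrite mul0r.
    by rewrite mulr_ge0_le0 ?ler0z ?b0 // y0 // (fintype.subsetP KT).
  lra.
have Ni : N (sroot i).
  split; [|exact: qpos_sroot|by rewrite ffunE eqxx].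
  by exists 1%g, i; rewrite qact1; split=> //; exact: parabolic1.
have Nrefl b k : k \in K -> N b -> pairing A b k < 0 -> N (qrefl A k b).
  move=> kK [rb b0 bi] neg.
  have ge l : b l <= qrefl A k b l by rewrite ffunE; case: (l == k) => /=; lia.
  split; [|by move=> l; exact: le_trans (ge l)|exact: lt_le_trans (ge i)].
  rewrite -(qact_simple D); apply: real_coroot_in_qact => //; exact: parabolic_simple.
have [b [rb b0 bi] btop] := exists_top NL Ni Nrefl.
have sumE k : \sum_(l in K) (b l)%:~R * (A l k)%:~R = (pairing A b k)%:~R :> R.
  rewrite /pairing rmorph_sum big_mkcond; apply: eq_bigr => l _.
  by case: ifPn => [_|/(suppK b rb)->]; rewrite ?rmorphM // mul0r.
apply: (finite_type_of_coroot symA (c := fun l => (b l)%:~R) iT).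
- by move=> k _; rewrite ler0z.
- by move=> k kK; rewrite sumE ler0z btop.
apply: contrapT => nex.
have zero k : k \in K -> pairing A b k = 0.
  move=> kK; apply/eqP; apply: contra_notT nex => p0; exists k => //.
  by rewrite sumE intr_eq0.
move: rb => [w [j [Kw jK bE]]].
have : qact w^-1%g b = b by apply: (qact_parabolic_pairing0 (parabolicV Kw)).
rewrite bE qactK => jE; have := zero j jK.
by rewrite bE -jE pairing_sroot gcm_diag.
Qed.

(** For the extremality, W_Theta moves x to a functional that is nonnegative on
Theta and fixes the point in between; then y becomes nonpositive on Theta, hence
zero by [antidominant_zero]. *)
Lemma RTheta_is_face Theta : special R A Theta -> is_face D (RTheta D Theta).
Proof.
move=> spT; right; split.
- by exists 0; split; [exact: tits_cone0|move=> i _; rewrite lfunE].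
- by move=> x [].
- move=> x y t; rewrite !inE => -[Xx x0] [Xy y0]; split.
    apply: tits_coneD;
    apply: tits_coneZ => //; by rewrite ?subr_ge0.
  by move=> i iT; rewrite convE add_lfunE !scale_lfunE x0 // y0 // !scaler0 addr0.
move=> x y t Xx Xy t01 [_ z0]; have [u Tu udom] := tits_dominantize Theta Xx.
have /andP[t0 t1] := t01.
have E i : i \in Theta ->
    t%:num * (u x (coroot D i) : R) + (1 - t%:num) * (u y (coroot D i) : R) = 0.
  move=> iT; rewrite -[RHS](z0 i iT) -(weyl_parabolic_fix Tu z0) convE.
  by rewrite linearD !linearZ add_lfunE !scale_lfunE.
have uy0 : forall i, i \in Theta -> u y (coroot D i) = 0.
  apply: antidominant_zero => //; first exact: tits_cone_weyl.
  by move=> i iT; have := E i iT; have := udom i iT; nra.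
have ux0 i : i \in Theta -> u x (coroot D i) = 0.
  move=> iT; have := E i iT; rewrite uy0 // mulr0 addr0 => /eqP.
  by rewrite mulf_eq0 gt_eqF //= => /eqP.
split; split=> //.
  by rewrite -(weylK u x) (weyl_parabolic_fix (parabolicV Tu) ux0).
by rewrite -(weylK u y) (weyl_parabolic_fix (parabolicV Tu) uy0).
Qed.

Lemma std_faceE Theta x : special R A Theta ->
  face_set (std_face D Theta) x <-> RTheta D Theta x.
Proof.
move=> spT; have /asboolP := RTheta_is_face spT.
by move=> P; rewrite /std_face; have -> := @insubdK _ _ _ (full_face D) _ P.
Qed.

End SpecialFaces.

(** * Double cosets and standard faces *)

Section SpecialParabolic.
Context (R : realType) (I : finType) (A : gcm I) (h : vectType R).
Context (symA : symmetrizable R A) (D : minimal_realization A h).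
Local Notation V := 'Hom(h, R^o).
Local Notation Q := {ffun I -> int}.
Implicit Types (lam mu nu : V) (i j k l : I) (J K Theta : {set I})
  (F G : face D) (a u v w y c : weyl D).

(** Let K be the component of k.  The coroots w h_i0 with w in W_K are positive,
with coordinate 1 at i0.  The coroot v h_i0 has a negative coordinate outside the
simple coroots v h_l, l in Theta, since otherwise h_i0 would be a combination of
the h_l; so v makes all these coroots negative.  Hence they are finitely many, and
the highest of them shows that K is of finite type. *)
Lemma no_adjacent_descent Theta v i0 k : special R A Theta ->
  (forall i, i \in Theta -> exists j, qact v (sroot i) = sroot j) ->
  i0 \notin Theta -> qpos (- qact v (sroot i0)) -> k \in Theta -> A i0 k != 0 -> False.
Proof.
move=> spT simT i0T neg kT adj; apply: (special_infinite spT kT).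
set K := component A Theta k; have KT : K \subset Theta by exact: component_sub.
have i0K : i0 \notin K by apply: contra i0T; exact: (fintype.subsetP KT).
have i0k : i0 != k by apply: contraNneq i0T => ->.
pose N (b : Q) := exists2 w : weyl D, parabolic K w & b = qact w (sroot i0).
have N_i0 b : N b -> b i0 = 1.
  by move=> [w Kw ->]; rewrite (qact_parabolic_notin _ Kw i0K) ffunE eqxx.
have N_supp b l : N b -> l \notin K -> l != i0 -> b l = 0.
  move=> [w Kw ->] lK li; rewrite (qact_parabolic_notin _ Kw lK) ffunE.
  by rewrite (negbTE li).
have N_real b : N b -> real_coroot D b by move=> [w _ ->]; exists w, i0.
have N_pos b : N b -> qpos b.
  by move=> Nb; apply: (@real_coroot_pos _ _ _ _ _ _ i0 (N_real b Nb)); rewrite N_i0.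
(* if there were no such j, h_i0 would be a combination of the h_i, i in Theta *)
have [j xj jT] : exists2 j, qact v (sroot i0) j != 0 &
    forall i, i \in Theta -> qact v (sroot i) <> sroot j.
  apply: contrapT => nex.
  have : (1 : int) = qact v^-1%g (qact v (sroot i0)) i0 by rewrite qactK ffunE eqxx.
  rewrite qact_sum big1 // => j _.
  have [->|xj] := eqVneq (qact v (sroot i0) j) 0; first by rewrite mul0r.
  have [[i iT ij]|nij] := pselect (exists2 i, i \in Theta & qact v (sroot i) = sroot j).
    rewrite -ij qactK ffunE; case: eqP => [ii0|_]; last by rewrite mulr0.
    by rewrite ii0 iT in i0T.
  by case: nex; exists j => // i iT ij; apply: nij; exists i.
have xj0 : qact v (sroot i0) j < 0.
  by rewrite lt_neqAle xj /=; have := neg j; rewrite ffunE oppr_ge0.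
have N_neg b : N b -> qpos (- qact v b).
  move=> Nb; have [p|//] := real_coroot_sign (real_coroot_qact v (N_real b Nb)).
  have := p j; rewrite qact_sum (bigD1 i0) //= N_i0 // mul1r big1 ?addr0; first by lia.
  move=> l li; have [lK|lK] := boolP (l \in K); last by rewrite N_supp // mul0r.
  have lT := fintype.subsetP KT l lK; have [m lm] := simT l lT.
  rewrite lm ffunE; case: eqP => [jm|_]; last by rewrite mulr0.
  by case: (jT l lT); rewrite lm jm.
have [L HL] := inversions_finite v.
have [|||b Nb btop] := @exists_top _ A K N L (sroot i0).
- by move=> b Nb; apply: HL; [exact: N_real|exact: N_pos|exact: N_neg].
- by exists 1%g; rewrite ?qact1 //; exact: parabolic1.
- move=> b m mK [w Kw ->] _; exists (simple D m * w)%g; last by rewrite qact_mul qact_simple.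
  by apply: parabolicM => //; exact: parabolic_simple.
have sumE m : \sum_(l in K) (b l)%:~R * (A l m)%:~R = (pairing A b m - A i0 m)%:~R :> R.
  rewrite /pairing [X in (X - _)%:~R](bigD1 i0) //= N_i0 // mul1r addrAC subrr add0r rmorph_sum.
  rewrite big_mkcond [RHS]big_mkcond; apply: eq_bigr => l _.
  case: ifPn => [lK|lK]; case: eqP => li //=; rewrite ?rmorphM //.
    by rewrite li (negbTE i0K) in lK.
  by rewrite N_supp ?mul0r //; apply/eqP.
have ai0 m : m \in K -> A i0 m <= 0.
  by move=> mK; apply: gcm_offdiag; apply: contraNneq i0K => ->.
apply: (finite_type_of_coroot symA (c := fun l => (b l)%:~R) kT).
- by move=> m _; rewrite ler0z N_pos.
- by move=> m mK; rewrite sumE ler0z; have := btop m mK; have := ai0 m mK; lia.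
exists k; first exact: component_id.
have kK : k \in K by exact: component_id.
rewrite sumE intr_eq0; apply/eqP; have := btop k kK; have := ai0 k kK.
by move/eqP: adj; lia.
Qed.

(** A letter of J at the right end of y can be removed.  When there is none, y
maps the simple coroots of J to positive coroots, and writing h_i as image of
y^-1 h_i one sees that y^-1 h_i is simple for each i in Theta.  A descent of y^-1
would be outside Theta and its orthogonal, which [no_adjacent_descent] excludes;
so y = 1. *)
Lemma special_support Theta J y : special R A Theta ->
  (forall i, i \in Theta :|: orth A Theta -> qpos (qact y^-1%g (sroot i))) ->
  (forall i l, i \in Theta -> l \notin J -> qact y^-1%g (sroot i) l = 0) ->
  Theta \subset J /\ parabolic (D := D) J y.
Proof.
move=> spT; have [n] := ubnP (weyl_length y); elim: n y => [//|n IHn] y.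
rewrite ltnS => yn pos supp.
have [y1|y1] := pselect (y = 1%g).
  split; last by rewrite y1; exact: parabolic1.
  apply/fintype.subsetP => i iT; apply: contraT => iJ; have := supp i i iT iJ.
  by rewrite y1 invg1 qact1 ffunE eqxx.
have [[j jJ neg]|nodesc] := pselect (exists2 j, j \in J & qpos (- qact y (sroot j))).
  have y1E i : qact (y * simple D j)^-1%g (sroot i) = qrefl A j (qact y^-1%g (sroot i)).
    by rewrite invgM simpleV qact_mul qact_simple.
  have [||| TJ Jy] := IHn (y * simple D j)%g.
  - exact: leq_trans (neg_length_lt neg) yn.
  - move=> i iT; rewrite y1E; apply: (@qrefl_pos _ _ _ _ D); [|exact: pos|].
      by apply: real_coroot_qact; exact: real_coroot_simple.
    move=> E; move: neg; rewrite -E qactVK => /(qpos_antisym (qpos_sroot i)).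
    exact: sroot_neq0.
  - move=> i l iT lJ; rewrite y1E qrefl_neq ?supp //.
    by apply: contraNneq lJ => ->.
  split=> //; rewrite -[y]mulg1 -(simpleK D j) mulgA.
  by apply: parabolicM => //; exact: parabolic_simple.
have posJ j : j \in J -> qpos (qact y (sroot j)).
  move=> jJ; have [//|neg] := real_coroot_sign (real_coroot_qact y (real_coroot_simple D j)).
  by case: nodesc; exists j.
have sim i : i \in Theta -> exists j, qact y^-1%g (sroot i) = sroot j.
  move=> iT; set b := qact y^-1%g (sroot i).
  have b0 : qpos b by apply: pos; rewrite inE iT.
  have [j bj] : exists j, b j != 0.
    apply: contrapT => nex; apply: (@sroot_neq0 _ i); apply: (@qact_eq0 _ _ _ _ D y^-1%g).
    by apply/ffunP => j; rewrite ffunE; apply/eqP; apply: contra_notT nex => bj; exists j.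
  have jJ : j \in J by apply: contraT => jJ; rewrite /b supp ?eqxx in bj.
  exists j; rewrite /b -(qactK y (sroot j)); congr (qact _ _); apply/esym.
  apply: (real_coroot_multiple (real_coroot_qact y (real_coroot_simple D j)) (posJ j jJ)) => l li.
  have : \sum_m b m * qact y (sroot m) l = 0.
    by rewrite -qact_sum qactVK ffunE (negbTE li).
  have t0 m : 0 <= b m * qact y (sroot m) l.
    have [mJ|mJ] := boolP (m \in J); first by rewrite mulr_ge0 // posJ.
    by rewrite /b supp // mul0r.
  move/eqP; rewrite psumr_eq0 // => /allP/(_ j (mem_index_enum j)) /=.
  by rewrite mulf_eq0 (negbTE bj) => /eqP.
have [i0 neg] : exists i0, qpos (- qact y^-1%g (sroot i0)).
  by apply: descent => yV; apply: y1; rewrite -[y]invgK yV invg1.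
have i0n : i0 \notin Theta :|: orth A Theta.
  apply/negP => /pos /qpos_antisym /(_ neg).
  by apply: real_coroot_neq0; apply: real_coroot_qact; exact: real_coroot_simple.
move: i0n; rewrite !inE negb_or => /andP[i0T /forall_inPn[k kT adj]].
by case: (no_adjacent_descent spT sim i0T neg kT adj).
Qed.

(** An element y of minimal length in the double coset is minimal on both sides. *)
Lemma double_coset K J w : exists a y c, [/\ parabolic K a, (min_left K `&` min_right J)%classic y,
  parabolic J c & w = (a * y * c)%g].
Proof.
pose P n := `[< exists a y c, [/\ parabolic K a, parabolic J c,
  weyl_length y = n & w = (a * y * c)%g] >].
have exP : exists n, P n.
  exists (weyl_length w); apply/asboolP; exists 1%g, w, 1%g.
  by split; rewrite ?mul1g ?mulg1 //; exact: parabolic1.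
case: (ex_minnP exP) => n /asboolP[a [y [c [Ka Jc yn wE]]]] min.
exists a, y, c; split=> //; split=> u Pu; rewrite yn; apply: min; apply/asboolP.
  exists (a * u^-1)%g, (u * y)%g, c; split=> //; last by rewrite mulgA mulgVK.
  by apply: parabolicM => //; exact: parabolicV.
exists a, (y * u)%g, (u^-1 * c)%g; split=> //; last by rewrite wE !mulgA mulgK.
by apply: parabolicM => //; exact: parabolicV.
Qed.

Lemma simple_comm i j : A i j = 0 -> commute (simple D i) (simple D j).
Proof.
move=> Aij; have ij : i != j by apply/eqP => ij; move: Aij; rewrite ij gcm_diag.
have := @braid _ _ _ _ D i j ij; rewrite Aij mul0r => /(_ isT) /=.
by rewrite /rev /= !word_cons word_nil !mulg1 => /esym.
Qed.

Lemma parabolic_orth Theta a : parabolic (Theta :|: orth A Theta) a ->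
  exists a1 a2 : weyl D, [/\ parabolic (orth A Theta) a1, parabolic Theta a2 & a = (a1 * a2)%g].
Proof.
elim/parabolic_ind => [|j w jT _ [a1 [a2 [P1 P2 ->]]]].
  by exists 1%g, 1%g; split; rewrite ?mulg1 //; exact: parabolic1.
have [jO|jO] := boolP (j \in orth A Theta).
  exists (simple D j * a1)%g, a2; split; rewrite ?mulgA //.
  by apply: parabolicM => //; exact: parabolic_simple.
have {jO}jT : j \in Theta by move: jT; rewrite inE (negbTE jO) orbF.
exists a1, (simple D j * a2)%g; split=> //.
  by apply: parabolicM => //; exact: parabolic_simple.
rewrite !mulgA; congr (_ * _)%g; elim/parabolic_ind: P1 => [|k u kO _ IH].
  by rewrite mulg1 mul1g.
have Akj : A k j = 0 by move: kO; rewrite inE => /forall_inP/(_ j jT)/eqP.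
by rewrite mulgA -(simple_comm Akj) -!mulgA IH.
Qed.

Lemma decomposition_exists Theta J w : exists a1 a2 y c, decomposition Theta J w a1 a2 y c.
Proof.
have [a [y [c [Ka Py Jc ->]]]] := double_coset (Theta :|: orth A Theta) J w.
have [a1 [a2 [P1 P2 ->]]] := parabolic_orth Ka.
by exists a1, a2, y, c; split.
Qed.

(** An i outside J cannot be the last letter, since the i-th coordinate of w h_i
is 1 for w in W_J. *)
Lemma reduced_parabolic J s : weyl_length (word D s) = size s -> parabolic J (word D s) ->
  {subset s <= J}.
Proof.
elim/last_ind: s => [//|s i IHs] ls Js.
have lt : (weyl_length (word D s) <= size s)%N by exact: length_word.
have le : (weyl_length (word D (rcons s i)) <= weyl_length (word D s) + 1)%N.
  rewrite word_rcons (leq_trans (length_mul _ _)) // leq_add2l -word1.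
  exact: length_word.
rewrite ls size_rcons in le.
have neg : qpos (- qact (word D (rcons s i)) (sroot i)).
  apply: length_lt_neg; rewrite {1}word_rcons -mulgA simpleK mulg1 ls size_rcons.
  by rewrite ltnS.
have iJ : i \in J.
  apply: contraT => iJ; have := neg i.
  by rewrite !ffunE (qact_parabolic_notin _ Js iJ) ffunE eqxx.
move=> j; rewrite mem_rcons inE => /orP[/eqP->//|]; apply: IHs => //; first by lia.
rewrite -[word D s]mulg1 -(simpleK D i) mulgA -word_rcons.
by apply: parabolicM => //; exact: parabolic_simple.
Qed.

Lemma red_parabolic J y : parabolic J y -> red y \subset J.
Proof.
move=> Jy; apply/fintype.subsetP => i; rewrite inE => /asboolP[s [sw ss]].
by apply: reduced_parabolic; rewrite sw.
Qed.

Lemma parabolic_red y : parabolic (red y) y.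
Proof.
have [s [sw ss]] := reduced_exists y; exists s => // i iS.
by rewrite inE; apply/asboolP; exists s.
Qed.

Lemma min_left_pos K y : min_left K y -> forall i, i \in K -> qpos (qact y^-1%g (sroot i)).
Proof.
move=> min i iK; apply: length_le_pos.
rewrite lengthV -[(y^-1 * _)%g]invgK invgM invgK simpleV lengthV.
by apply: min; exact: parabolic_simple.
Qed.

(** The value of y p_J on h_i is the sum of the coordinates of y^-1 h_i outside
J.  They are nonnegative, so they vanish together with their sum. *)
Lemma RTheta_facet_point Theta J y : special R A Theta -> min_left (Theta :|: orth A Theta) y ->
  RTheta D Theta (y (facet_point D J)) <-> Theta :|: red y \subset J.
Proof.
move=> spT ymin; rewrite finset.subUset; split=> [[_ y0]|/andP[TJ yJ]]; last first.
  rewrite (parabolic_facet_pointS yJ (parabolic_red y)); split.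
    by apply: dominant_tits; exact: facet_point_dominant.
  by move=> i /(fintype.subsetP TJ) iJ /=; rewrite facet_pointE iJ.
have [|TJ Jy] := @special_support Theta J y spT (min_left_pos ymin); last first.
  by rewrite TJ red_parabolic.
move=> i l iT lJ; have := y0 i iT; rewrite -ev_sroot evV.
have pos : qpos (qact y^-1%g (sroot i)) by apply: (min_left_pos ymin); rewrite inE iT.
move/eqP; rewrite psumr_eq0; last by move=> j _; rewrite mulr_ge0 ?ler0z ?pos // facet_pointE ler0n.
move=> /allP/(_ l (mem_index_enum l)) /=; rewrite facet_pointE lJ mulr1 intr_eq0.
by move/eqP.
Qed.

End SpecialParabolic.

(** * Classification of the faces *)

Section FaceClassification.
Context (R : realType) (I : finType) (A : gcm I) (h : vectType R).
Context (symA : symmetrizable R A) (D : minimal_realization A h).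
Local Notation V := 'Hom(h, R^o).
Implicit Types (lam mu nu : V) (i j k l : I) (J K Theta : {set I}) (F G : face D) (u v w : weyl D).

Lemma parabolic_coroot_fix K w lam i : parabolic K w -> (forall l, l \in K -> A i l = 0) ->
  w lam (coroot D i) = lam (coroot D i).
Proof.
move=> Kw Ai; rewrite -!ev_sroot evV; congr (ev _ _ _).
by apply: (qact_parabolic_pairing0 (parabolicV Kw)) => l /Ai; rewrite pairing_sroot.
Qed.

(** The facets of minimal type are those in the relative interior of the face. *)
Definition minimal_type J G := face_set G (facet_point D J) /\
  forall w K, face_set G (w (facet_point D K)) -> (#|J| <= #|K|)%N.

(** Otherwise J has a component K of finite type.  Take a combination gam of the
alpha_k, k in K, that is positive on K.  The point p_J - e gam is in X, since W_K
moves it to a dominant point, and p_J + e' gam is dominant of type J :\: K.  As p_J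
is between them, the face contains a facet of smaller type. *)
Lemma minimal_type_special J G : minimal_type J G -> special R A J.
Proof.
move=> [GJ min]; apply/eqP; apply: contraT => Jn.
have [k kJ kfin] : exists2 k, k \in J & finite_type (gcm_submx R A (component A J k)).
  apply: contrapT => nex; move/eqP: Jn; apply; apply/setP => k; rewrite inE.
  apply/idP/andP => [kJ|[]//]; split=> //; apply/asboolPn => kfin.
  by apply: nex; exists k.
set K := component A J k in kfin; have KJ : K \subset J by exact: component_sub.
have kK : k \in K by exact: component_id.
have [c c0 Mc0] := finite_type_pos kfin.
pose gam : V := \sum_(l in K) c l *: Defs.root D l.
have gamE i : (gam (coroot D i) : R) = \sum_(l in K) (A i l)%:~R * c l.
  rewrite sum_lfunE; apply: eq_bigr => l _.
  by rewrite scale_lfunE root_coroot mulrC.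
have adj0 i l : i \in J -> i \notin K -> l \in K -> A i l = 0.
  move=> iJ iK lK; apply/eqP; apply: contraR iK => Ail.
  apply: (component_adj kJ lK iJ); apply: contra_neq Ail; exact: gcm_zero.
have gam_J i : i \in J -> i \notin K -> (gam (coroot D i) : R) = 0.
  by move=> iJ iK; rewrite gamE big1 // => l lK; rewrite adj0 // mul0r.
have [u Ku udom] := finite_dominantize symA D (- gam) kfin.
have [i ri|e e0 [dom _]] := @dominant_perturb _ _ _ _ D (facet_point D J) (u (- gam))
    (@facet_point_dominant _ _ _ _ D J).
  have iJ : i \in J by rewrite -(zeros_facet_point D J) inE ri.
  have [iK|iK] := boolP (i \in K); first exact: udom.
  rewrite (parabolic_coroot_fix _ Ku); first by rewrite opp_lfunE gam_J ?oppr0.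
  by move=> l; exact: adj0.
have X1 : tits_cone D (facet_point D J - e *: gam).
  rewrite -(weylK u (_ - _)); apply/tits_cone_weyl/dominant_tits.
  rewrite linearB linearZ /= (parabolic_facet_pointS KJ Ku) -scalerN -linearN; exact: dom.
have [i ri|e' e'0 [dom' zeros']] := @dominant_perturb _ _ _ _ D (facet_point D J) gam
    (@facet_point_dominant _ _ _ _ D J).
  have iJ : i \in J by rewrite -(zeros_facet_point D J) inE ri.
  have [iK|iK] := boolP (i \in K); last by rewrite gam_J.
  by rewrite gamE ltW // Mc0.
have : face_set G (e *: (facet_point D J + e' *: gam)).
  apply: (@face_summand _ _ _ _ _ _ _ (e' *: (facet_point D J - e *: gam))).
  - by apply: tits_coneZ; [exact: ltW|exact: dominant_tits].
  - exact: (tits_coneZ (ltW e'0) X1).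
  (* p_J, up to a factor, as a sum of multiples of the two endpoints *)
  have -> : e *: (facet_point D J + e' *: gam) + e' *: (facet_point D J - e *: gam) =
      (e + e') *: facet_point D J.
    rewrite scalerBr !scalerDr scalerDl !scalerA [e' * e]mulrC addrACA.
    by rewrite subrr addr0.
  by apply: face_scale => //; rewrite ltW // addr_gt0.
move/(face_scale (a := e^-1)); rewrite scalerA mulVf ?gt_eqF // scale1r invr_ge0.
move=> /(_ (ltW e0)) GJ'; have : face_set G ((1%g : weyl D) (facet_point D J + e' *: gam)).
  by rewrite weyl_oneE.
move/(face_facet G 1%g dom')/min; rewrite zeros' zeros_facet_point.
rewrite leqNgt => /negP[]; apply: proper_card; apply/properP; split.
  by apply/fintype.subsetP => i; rewrite inE => /andP[].
exists k => //; rewrite inE kJ /=; apply/negP => /eqP gk.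
by have := Mc0 k kK; rewrite -gamE gk ltxx.
Qed.

(** A point lam of R(J) is in the face since p_J - e lam is dominant.  Conversely, let nu
be in the face.  An element u of W_J, which fixes p_J, makes nu nonnegative on J;
then p_J + e u nu is dominant of type contained in J, hence equal to J by
minimality, and nu vanishes on J. *)
Lemma minimal_type_face J G : minimal_type J G -> G = std_face D J.
Proof.
move=> /[dup] /minimal_type_special spJ [GJ min].
apply: face_ext => nu; rewrite (std_faceE symA D _ spJ); split=> [Gnu|[Xnu nu0]].
  split; first exact: face_tits Gnu.
  have [u Ju udom] := tits_dominantize J (face_tits Gnu).
  have [i ri|e e0 [dom zeros']] := @dominant_perturb _ _ _ _ D (facet_point D J) (u nu)
    (@facet_point_dominant _ _ _ _ D J).
    by apply: udom; rewrite -(zeros_facet_point D J) inE ri.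
  have : face_set G (u^-1%g (facet_point D J + e *: u nu)).
    rewrite linearD linearZ /= weylK (parabolic_facet_point (parabolicV Ju)).
    by apply: face_add => //; apply: face_scale => //; exact: ltW.
  move/(face_facet G u^-1%g dom)/min; rewrite zeros' zeros_facet_point => le.
  have unu0 i : i \in J -> u nu (coroot D i) = 0.
    set Z := [set _ in _ | _] in le; have ZJ : Z \subset J.
      by apply/fintype.subsetP => l; rewrite inE => /andP[].
    have /eqP ZE : Z == J by rewrite eqEcard ZJ.
    by rewrite -{1}ZE inE => /andP[_ /eqP].
  by rewrite -(weylK u nu) (weyl_parabolic_fix (parabolicV Ju) unu0).
have [i ri|e e0 [dom _]] := @dominant_perturb _ _ _ _ D (facet_point D J) (- nu)
    (@facet_point_dominant _ _ _ _ D J).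
  by rewrite opp_lfunE nu0 ?oppr0 // -(zeros_facet_point D J) inE ri.
have : face_set G (e *: nu).
  apply: (@face_summand _ _ _ _ _ _ _ (facet_point D J + e *: - nu)).
  - by apply: tits_coneZ => //; exact: ltW.
  - exact: dominant_tits.
  - by rewrite scalerN addrCA subrr addr0.
move/(face_scale (a := e^-1)); rewrite scalerA mulVf ?gt_eqF // scale1r invr_ge0.
by apply; exact: ltW.
Qed.

Lemma face_act_mul v w F : face_act v (face_act w F) = face_act (v * w)%g F.
Proof.
by apply: face_ext => x; rewrite !face_actE invgM weyl_mulE.
Qed.

Lemma face_classification F :
  exists w Theta, special R A Theta /\ F = face_act w (std_face D Theta).
Proof.
pose P J := `[< exists w, face_set F (w (facet_point D J)) >].
have PT : P [set: I] by apply/asboolP; exists 1%g; exact: face_facet_pointT.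
case: (arg_minnP (fun J : {set I} => #|J|) PT) => J /asboolP[w FJ] min.
have minG : minimal_type J (face_act w^-1%g F).
  split; first by apply/face_actE; rewrite invgK.
  move=> v K /face_actE; rewrite invgK -weyl_mulE => FK; apply: min.
  by apply/asboolP; exists (w * v)%g.
exists w, J; split; first exact: minimal_type_special minG.
by rewrite -(minimal_type_face minG) face_act_mul mulgV face_act1.
Qed.

End FaceClassification.

(** * The good action *)

Section GoodAction.
Context (R : realType) (I : finType) (A : gcm I) (h : vectType R).
Context (symA : symmetrizable R A) (D : minimal_realization A h).
Local Notation V := 'Hom(h, R^o).
Implicit Types (lam mu nu : V) (i j k l : I) (J K H Theta : {set I})
  (F G : face D) (a b u v w : weyl D).
Implicit Types (x y : face_monoid D) (c d : coxeter_complex D).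

Lemma face_facet_pointS F w J K :
  J \subset K -> face_set F (w (facet_point D J)) -> face_set F (w (facet_point D K)).
Proof.
move=> JK FJ; apply: (@face_summand _ _ _ _ _ _ _ (w (facet_point D J - facet_point D K))).
- by apply/tits_cone_weyl/dominant_tits/facet_point_dominant.
- apply/tits_cone_weyl/dominant_tits => i; rewrite add_lfunE opp_lfunE !facet_pointE.
  have [iJ|iJ] := boolP (i \in J); first by rewrite (fintype.subsetP JK i iJ) subrr.
  by case: (i \in K); rewrite /= ?subr0 ?subrr ?ler01.
by rewrite -linearD addrC subrK.
Qed.

(** The type of the smallest coset that contains w W_J and is represented in F. *)
Definition face_hull F w J : {set I} :=
  [set i | `[< forall K, J \subset K -> face_set F (w (facet_point D K)) -> i \in K >]].

Lemma face_hull_min F w J K :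
  J \subset K -> face_set F (w (facet_point D K)) -> face_hull F w J \subset K.
Proof.
by move=> JK FK; apply/fintype.subsetP => i; rewrite inE => /asboolP; apply.
Qed.

Lemma sub_face_hull F w J : J \subset face_hull F w J.
Proof.
apply/fintype.subsetP => i iJ; rewrite inE; apply/asboolP => K /fintype.subsetP JK _.
exact: JK.
Qed.

Lemma face_hullP F w J : face_set F (w (facet_point D (face_hull F w J))).
Proof.
pose P K := `[< J \subset K /\ face_set F (w (facet_point D K)) >].
have PT : P [set: I] by apply/asboolP; split; [exact: finset.subsetT|exact: face_facet_pointT].
case: (arg_minnP (fun K : {set I} => #|K|) PT) => K /asboolP[JK FK] min.
suff -> : face_hull F w J = K by [].
apply/eqP; rewrite finset.eqEsubset face_hull_min //=; apply/fintype.subsetP => i iK.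
rewrite inE; apply/asboolP => L JL FL.
have : (#|K| <= #|K :&: L|)%N.
  by apply: min; apply/asboolP; split; [rewrite finset.subsetI JK|exact: face_facet_pointI].
move=> le; have /eqP KLE : K :&: L == K by rewrite eqEcard finset.subsetIl.
by move: iK; rewrite -KLE inE => /andP[].
Qed.

Lemma face_hull_eq F w J H : J \subset H -> face_set F (w (facet_point D H)) ->
  (forall K, J \subset K -> face_set F (w (facet_point D K)) -> H \subset K) -> face_hull F w J = H.
Proof.
move=> JH FH Hmin; apply/eqP; rewrite finset.eqEsubset face_hull_min //=.
by apply: Hmin; [exact: sub_face_hull|exact: face_hullP].
Qed.

Lemma face_hull_id F w J : face_set F (w (facet_point D J)) -> face_hull F w J = J.
Proof. by move=> FJ; apply: face_hull_eq. Qed.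

Definition cc_pair c : weyl D * {set I} :=
  projT1 (cid (let: ex_intro w (ex_intro J e) := cc_cosetP c in
               ex_intro (fun p => c = cc_coset p.1 p.2) (w, J) e)).

Lemma cc_pairE c : c = cc_coset (cc_pair c).1 (cc_pair c).2.
Proof. by rewrite /cc_pair; case: cid. Qed.

(** The definition goes through representatives, both of the element of the
monoid and of the coset; the result depends on neither by [face_monoid_actE]. *)
Definition face_monoid_act x c : coxeter_complex D :=
  let p := repr x in let q := cc_pair c in cc_coset (p.1 * q.1)%g (face_hull p.2 q.1 q.2).

Lemma face_monoid_actE a F v J :
  face_monoid_act (sigma_eps a F) (cc_coset v J) =
  cc_coset (a * v)%g (face_hull F v J).
Proof.
rewrite /face_monoid_act; set p := repr _; set q := cc_pair _.
have [FE pa] : p.2 = F /\ forall t, face_set p.2 t -> p.1 t = a t.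
  by apply/sigma_epsP; rewrite /p /sigma_eps -surjective_pairing reprK.
have /cc_coset_eq[JE Jqv] := cc_pairE (cc_coset v J); rewrite -/q in JE Jqv.
have qv K : J \subset K -> q.1 (facet_point D K) = v (facet_point D K).
  move=> JK; rewrite -[in RHS](mulVKg q.1 v) weyl_mulE (parabolic_facet_pointS _ Jqv) //.
  by rewrite -JE.
have hullE : face_hull p.2 q.1 q.2 = face_hull F v J.
  rewrite FE -JE; apply/setP => i; rewrite !inE; apply/asboolP/asboolP => hyp K JK.
    by rewrite -qv //; apply: hyp.
  by rewrite qv //; apply: hyp.
rewrite hullE; apply/cc_coset_eq; split=> //; apply: facet_point_fix.
have Fv := face_hullP F v J; set H := face_hull F v J in Fv *.
rewrite weyl_mulE [(p.1 * _)%g _]weyl_mulE qv ?sub_face_hull // pa ?FE //.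
by rewrite -(weyl_mulE a) weylK.
Qed.

(** A coset above one that is represented in a face is again represented there,
so going up to G and then up to F ends at the smallest coset for F cap G. *)
Lemma act_monoid : monoid_action face_monoid_act.
Proof.
split=> [t|x y t].
  have [v [J ->]] := cc_cosetP t; rewrite [LHS]face_monoid_actE mul1g face_hull_id //.
  exact/tits_cone_weyl/dominant_tits/facet_point_dominant.
elim/sigma_eps_ind: x => a F; elim/sigma_eps_ind: y => b G.
have [v [J ->]] := cc_cosetP t.
have -> : (sigma_eps a F * sigma_eps b G)%g = _ := face_monoid_mulE a F b G.
rewrite !face_monoid_actE mulgA; congr cc_coset; set H := face_hull G v J.
apply: face_hull_eq.
- by apply: fintype.subset_trans (sub_face_hull _ _ _); exact: sub_face_hull.
- split; first by apply/face_actE; rewrite invgK -weyl_mulE; exact: face_hullP.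
  by apply: face_facet_pointS (face_hullP _ _ _); exact: sub_face_hull.
- move=> K JK [/face_actE]; rewrite invgK -weyl_mulE => FK GK.
  by apply: face_hull_min FK; exact: face_hull_min.
Qed.

Lemma act_weyl : extends_weyl face_monoid_act.
Proof.
move=> w c; have [v [J ->]] := cc_cosetP c; rewrite /of_weyl.
rewrite face_monoid_actE face_hull_id; last first.
  exact/tits_cone_weyl/dominant_tits/facet_point_dominant.
apply/seteqP; split=> [_ [u Ju <-]|_ [_ [u Ju <-] <-]].
  by exists (v * u)%g; [exists u|rewrite mulgA].
by exists u; rewrite ?mulgA.
Qed.

Lemma act_le x c d : cc_le c d -> cc_le (face_monoid_act x c) (face_monoid_act x d).
Proof.
elim/sigma_eps_ind: x => a F; have [w [J ->]] := cc_cosetP c.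
have [v [K ->]] := cc_cosetP d => /left_coset_sub[KJ Jwv].
have -> : cc_coset w J = cc_coset v J.
  by apply/cc_coset_eq; split=> //; rewrite -[w]invgK -invgM; exact: parabolicV.
rewrite !face_monoid_actE; apply/left_coset_sub; rewrite mulVg; split; last exact: parabolic1.
by apply: face_hull_min (face_hullP _ _ _); apply: fintype.subset_trans KJ (sub_face_hull _ _ _).
Qed.

(** The coset of a point of F keeps its type under a eps(F), hence under b eps(G)
as well; so it is represented in G too, and its images under a and b agree.  The
stabilizer of a facet fixes it pointwise, so a and b agree on the point itself. *)
Lemma act_faithful : faithful_action face_monoid_act.
Proof.
elim/sigma_eps_ind => a F; elim/sigma_eps_ind => b G E.
have main a' b' F' G' :
    (forall t, face_monoid_act (sigma_eps a' F') t = face_monoid_act (sigma_eps b' G') t) ->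
    forall t, face_set F' t -> face_set G' t /\ a' t = b' t.
  move=> E' t Ft; have [v [mu [dom tE]]] := face_tits Ft.
  move: Ft; rewrite {}tE => /(face_facet F' v dom) Fv.
  have := E' (cc_coset v (zeros D mu)); rewrite !face_monoid_actE face_hull_id //.
  move=> /cc_coset_eq[ZE]; rewrite -ZE => par.
  split; first by apply/(face_facet G' v dom); rewrite ZE; exact: face_hullP.
  have : ((b' * v)^-1 * (a' * v))%g mu = mu.
    by apply: (weyl_parabolic_fix par) => j; rewrite inE => /eqP.
  by move/(congr1 (b' * v)%g); rewrite -weyl_mulE mulVKg !weyl_mulE.
apply/sigma_epsP; split; last by move=> t /(main _ _ _ _ E)[].
by apply: face_ext => t; split=> [/(main _ _ _ _ E)[]|/(main _ _ _ _ (fun t => esym (E t)))[]].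
Qed.

Lemma RTheta_parabolic Theta w lam : parabolic (Theta :|: orth A Theta) w ->
  RTheta D Theta lam -> RTheta D Theta (w lam).
Proof.
move=> Tw [Xl l0]; split; first exact: tits_cone_weyl.
elim/parabolic_ind: Tw => [|j u jT _ IH] i iT; first by rewrite weyl_oneE l0.
rewrite weyl_mulE /= comp_lfun1r reflectionE add_lfunE opp_lfunE scale_lfunE.
rewrite IH // root_coroot; move: jT; rewrite inE => /orP[jT|].
  by rewrite IH // scale0r subrr.
by rewrite inE => /forall_inP/(_ i iT)/eqP/gcm_zero ->; rewrite scaler0 subrr.
Qed.

Lemma RTheta_parabolicE Theta w lam : parabolic (Theta :|: orth A Theta) w ->
  RTheta D Theta (w lam) <-> RTheta D Theta lam.
Proof.
move=> Tw; split; last exact: RTheta_parabolic.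
by move=> /(RTheta_parabolic (parabolicV Tw)); rewrite weylK.
Qed.

(** The factors a1 and a2 stabilize R(Theta), and c fixes the facet point. *)
Lemma decomposition_RTheta Theta J w a1 a2 (y c : weyl D) K : special R A Theta ->
  decomposition Theta J w a1 a2 y c -> J \subset K ->
  RTheta D Theta (w (facet_point D K)) <-> Theta :|: red y \subset K.
Proof.
move=> spT [P1 P2 [ymin _] Jc ->] JK.
rewrite weyl_mulE (parabolic_facet_pointS JK Jc) weyl_mulE RTheta_parabolicE.
  exact: RTheta_facet_point.
by apply: parabolicM; [apply: parabolicS P1|apply: parabolicS P2];
  rewrite ?finset.subsetUl ?finset.subsetUr.
Qed.

Lemma weyl_eps_weyl v F w :
  (of_weyl v * eps F * of_weyl w)%g = sigma_eps (v * w)%g (face_act w^-1%g F) :> face_monoid D.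
Proof.
have -> : (of_weyl v * eps F * of_weyl w)%g =
  face_monoid_mul (face_monoid_mul (of_weyl v) (eps F)) (of_weyl w) by [].
rewrite /of_weyl /eps !face_monoid_mulE mulg1 invg1 face_act1.
by rewrite face_cap_fulll face_cap_fullr.
Qed.

Lemma act_given : given_by_decomposition face_monoid_act.
Proof.
move=> s1 s2 t Theta J a1 a2 y c spT dec.
rewrite weyl_eps_weyl face_monoid_actE.
have FE K : J \subset K -> face_set (face_act s2^-1%g (std_face D Theta)) (t (facet_point D K)) <->
    Theta :|: red y \subset K.
  move=> JK; rewrite face_actE invgK (std_faceE symA D _ spT) -weyl_mulE.
  exact: decomposition_RTheta dec JK.
have -> : face_hull (face_act s2^-1%g (std_face D Theta)) t J = Theta :|: J :|: red y.
  have JH : J \subset Theta :|: J :|: red y by rewrite finset.setUAC finset.subsetUr.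
  apply: face_hull_eq => //; first by apply/FE => //; rewrite finset.setUAC finset.subsetUl.
  by move=> K JK /FE-/(_ JK) TK; rewrite finset.setUAC finset.subUset TK.
have [P1 P2 _ Jc wE] := dec.
apply/cc_coset_eq; split=> //.
have -> : ((s1 * a1)^-1 * (s1 * s2 * t) = a2 * y * c)%g.
  by rewrite -(mulgA s1) wE invgM -!mulgA mulKg mulKg.
have sub3 : [/\ Theta \subset Theta :|: J :|: red y, J \subset Theta :|: J :|: red y &
    red y \subset Theta :|: J :|: red y].
  have : Theta :|: J :|: red y \subset Theta :|: J :|: red y by [].
  by rewrite !finset.subUset => /andP[/andP[-> ->] ->].
have [TH JH yH] := sub3.
apply: parabolicM; last exact: parabolicS Jc.
by apply: parabolicM; [exact: parabolicS P2|exact: parabolicS (parabolic_red y)].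
Qed.

(** If x = a eps(F) fixes W_J, then F contains p_J.  Write F = v R(Theta) and
decompose v^-1 as a1 a2 y c: then Theta and red(y) are contained in J, and
F = (y c)^-1 R(Theta). *)
Lemma act_stabilizer J :
  [set x | face_monoid_act x (cc_coset 1%g J) = cc_coset 1%g J]%classic = std_parabolic (D := D) J.
Proof.
apply/seteqP; split=> [x|_ [s [t [Theta [Js Jt TJ spT ->]]]]] /=; last first.
  rewrite face_monoid_actE face_hull_id.
    by apply/cc_coset_eq; split=> //; rewrite invg1 mul1g mulg1.
  rewrite weyl_oneE; apply/face_actE; rewrite (parabolic_facet_point (parabolicV Jt)).
  apply/(std_faceE symA D _ spT); split; first exact/dominant_tits/facet_point_dominant.
  by move=> i /(fintype.subsetP TJ) iJ /=; rewrite facet_pointE iJ.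
elim/sigma_eps_ind: x => a F; rewrite face_monoid_actE => /cc_coset_eq[hJ].
rewrite mulg1 invg1 mul1g => Ja.
have := face_hullP F 1%g J; rewrite hJ weyl_oneE.
have [v [Theta [spT ->]]] := face_classification symA F => /face_actE.
have [a1 [a2 [y [c dec]]]] := decomposition_exists Theta J v^-1%g.
move/(std_faceE symA D _ spT)/(decomposition_RTheta spT dec (fintype.subxx J)).
rewrite finset.subUset => /andP[TJ yJ]; have [P1 P2 _ Jc vE] := dec.
exists a, (c^-1 * y^-1)%g, Theta; split=> //.
  by apply: parabolicM; apply: parabolicV => //; exact: parabolicS (parabolic_red y).
congr sigma_eps; apply: face_ext => t; rewrite !face_actE !(std_faceE symA D _ spT) vE.
rewrite invgM !invgK -mulgA weyl_mulE RTheta_parabolicE //.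
by apply: parabolicM; [apply: parabolicS P1|apply: parabolicS P2];
  rewrite ?finset.subsetUl ?finset.subsetUr.
Qed.

(** By the classification of the faces every element of the monoid has the form
that the formula requires, and decompositions always exist. *)
Lemma given_unique act' : given_by_decomposition (D := D) act' -> face_monoid_act = act'.
Proof.
move=> given'; apply/funext => x; apply/funext => c.
elim/sigma_eps_ind: x => a F; have [t [J ->]] := cc_cosetP c.
have [v [Theta [spT ->]]] := face_classification symA F.
have -> : sigma_eps a (face_act v (std_face D Theta)) =
    (of_weyl (a * v) * eps (std_face D Theta) * of_weyl v^-1)%g.
  by rewrite weyl_eps_weyl invgK mulgK.
have [a1 [a2 [y [c' dec]]]] := decomposition_exists Theta J (v^-1 * t)%g.
by rewrite (act_given _ spT dec) (given' _ _ _ _ _ _ _ _ _ spT dec).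
Qed.

End GoodAction.

Theorem proposition4p7 (R : realType) (I : finType) (A : gcm I)
    (symA : symmetrizable R A) (h : vectType R)
    (D : minimal_realization A h) :
  (forall (Theta J : {set I}) (sigma2 tau : weyl D), special R A Theta ->
     exists a1 a2 y c, decomposition Theta J (sigma2 * tau)%g a1 a2 y c) /\
  (exists act : face_monoid D -> coxeter_complex D -> coxeter_complex D,
     [/\ unique (given_by_decomposition (D := D)) act,
         good_action act & faithful_action act]).
Proof.
split=> [Theta J s2 t _|]; first exact: decomposition_exists.
exists (@face_monoid_act R I A h D); split; last exact: act_faithful.
  by split; [exact: act_given|exact: given_unique].
split; [exact: act_monoid|exact: act_weyl|exact: act_stabilizer|].
by move=> x c d; exact: act_le.
Qed.
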